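(* Let $q\in\mathbb{C}^*$ be not a root of unity, $j_1,j_2\in\frac12\mathbb{N}$, and $a,b,u_1,u_2\in\mathbb{C}^*$. Assume: (i) for any $\varepsilon_1,\varepsilon_2\in\{\pm1\}$, the $q$-strings $S(2j_1,(q/u_1^2)^{\varepsilon_1})$ and $S(2j_2,(q/u_2^2)^{\varepsilon_2})$ are in general position; (ii) for $i=1,2$, $ab,\ a/b\notin S(2j_i,q/u_i^2)\cup S(2j_i,(q/u_i^2)^{-1})$; (iii) $\pm a,\pm b\notin\{q^{-2j_1-2j_2+1},\dots,q^{2j_1+2j_2-1}\}$. Then the overlap coefficients between the eigenbasis $\{\overline{\mathfrak{w}}_{k_1,k_2}\}$ of $\mathcal{B}_{21}$ and the eigenbasis $\{\mathfrak{u}_{\ell_1,\ell_2}\}$ of $\mathcal{A}_{12}$, for the TD pair $(\mathcal{A}_{12},\mathcal{B}_{21})$, are $$S_{k_1,k_2}(\ell_1,\ell_2)=R_{k_1}(\ell_1;aq^{2\ell_2-2j_2},bq^{2k_2-2j_2},u_1,j_1,q)\,R_{k_2}(\ell_2;a,b,u_2,j_2,q),$$ i.e. $\overline{\mathfrak{w}}_{k_1,k_2}=\sum_{\ell_1=0}^{2j_1}\sum_{\ell_2=0}^{2j_2}S_{k_1,k_2}(\ell_1,\ell_2)\,\mathfrak{u}_{\ell_1,\ell_2}$; and those between the eigenbasis $\{\mathfrak{w}_{k_1,k_2}\}$ of $\mathcal{B}_{12}$ and the eigenbasis $\{\overline{\mathfrak{u}}_{\ell_1,\ell_2}\}$ of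 $\mathcal{A}_{21}$, for the TD pair $(\mathcal{A}_{21},\mathcal{B}_{12})$, are $$\overline{S}_{k_1,k_2}(\ell_1,\ell_2)=R_{k_1}(\ell_1;a,b,u_1,j_1,q)\,R_{k_2}(\ell_2;aq^{2\ell_1-2j_1},bq^{2k_1-2j_1},u_2,j_2,q),$$ i.e. $\mathfrak{w}_{k_1,k_2}=\sum_{\ell_1=0}^{2j_1}\sum_{\ell_2=0}^{2j_2}\overline{S}_{k_1,k_2}(\ell_1,\ell_2)\,\overline{\mathfrak{u}}_{\ell_1,\ell_2}$ (for $0\le k_i\le 2j_i$).
   Context: $\mathbb{C}_{2j}[z]$ is the space of polynomials in $z$ of degree at most $2j$. $(z;q)_n=\prod_{k=0}^{n-1}(1-zq^k)$, $(z;q)_0=1$; $(z_1,\dots,z_p;q)_n=\prod_i(z_i;q)_n$; $\left[\begin{smallmatrix}n\\ \ell\end{smallmatrix}\right]_q=\frac{(q;q)_n}{(q;q)_\ell(q;q)_{n-\ell}}$; ${}_4\phi_3\left({q^{-n},a_1,a_2,a_3\atop b_1,b_2,b_3}\big|q,z\right)=\sum_{k=0}^n\frac{(q^{-n},a_1,a_2,a_3;q)_k}{(q,b_1,b_2,b_3;q)_k}z^k$ (in base $q^2$, replace $q$ by $q^2$). For $0\le k,\ell\le 2j$, $$R_k(\ell;a,b,u,j,q)=q^{2\ell(\ell-2j)}\left[\begin{smallmatrix}2j\\ \ell\end{smallmatrix}\right]_{q^2}\frac{(q^{2-2j}abu^{-2};q^2)_\ell\,(q^{2-2j}a^{-1}bu^{-2};q^2)_{2j-\ell}\,(q^{2+2j-2k}a^{-1}b^{-1}u^{-2};q^2)_k}{(q^{2\ell-4j}a^2;q^2)_\ell\,(q^{-2\ell}a^{-2};q^2)_{2j-\ell}\,(q^{2-2j}a^{-1}bu^{-2};q^2)_k}\;{}_4\phi_3\left({q^{-2k},\,q^{2k-4j}b^2,\,q^{-2\ell},\,q^{2\ell-4j}a^2\atop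 q^{-4j},\,q^{-2j}abu^2,\,q^{2-2j}abu^{-2}}\Big|q^2,q^2\right).$$ With $p_n(z;a,j,q)=(za;q^2)_n(z/a;q^2)_{2j-n}$, for $0\le n_i\le 2j_i$: $\mathfrak{u}_{n_1,n_2}=p_{n_1}(z_1u_1q^{-j_1};aq^{2n_2-2j_2},j_1,q)\,p_{n_2}(z_2u_2q^{-j_2};a,j_2,q)$, $\mathfrak{w}_{n_1,n_2}=p_{n_1}(z_1q^{j_1}u_1^{-1};b^{-1},j_1,q^{-1})\,p_{n_2}(z_2q^{j_2}u_2^{-1};b^{-1}q^{2j_1-2n_1},j_2,q^{-1})$, $\overline{\mathfrak{u}}_{n_1,n_2}=p_{n_1}(z_1u_1q^{-j_1};a,j_1,q)\,p_{n_2}(z_2u_2q^{-j_2};aq^{2n_1-2j_1},j_2,q)$, $\overline{\mathfrak{w}}_{n_1,n_2}=p_{n_1}(z_1q^{j_1}u_1^{-1};b^{-1}q^{2j_2-2n_2},j_1,q^{-1})\,p_{n_2}(z_2q^{j_2}u_2^{-1};b^{-1},j_2,q^{-1})$. Operators on $\mathbb{C}_{2j_1}[z_1]\otimes\mathbb{C}_{2j_2}[z_2]$, with $\alpha=a+a^{-1}$, $\beta=b+b^{-1}$, $T^{(1)}_\pm f(z_1,z_2)=f(q^{\pm1}z_1,z_2)$, $T^{(2)}_\pm f(z_1,z_2)=f(z_1,q^{\pm1}z_2)$, $i=1,2$: $\mathcal{A}_i=u_iz_iq^{j_i}+u_i^{-1}z_i^{-1}q^{-j_i}-u_i^{-1}q^{-j_i}z_i^{-1}(1-z_iu_iq^{-j_i}a)(1-z_iu_iq^{-j_i}a^{-1})(T^{(i)}_+)^2$,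 $\mathcal{B}_i=u_i^{-1}z_iq^{-j_i}+u_iz_i^{-1}q^{j_i}-u_iq^{j_i}z_i^{-1}(1-z_iu_i^{-1}q^{j_i}b)(1-z_iu_i^{-1}q^{j_i}b^{-1})(T^{(i)}_-)^2$, $\mathcal{A}_{12}=\mathcal{A}_1+q^{-2j_1}(T^{(1)}_+)^2(\mathcal{A}_2-\alpha)$, $\mathcal{B}_{12}=\mathcal{B}_2+(\mathcal{B}_1-\beta)q^{2j_2}(T^{(2)}_-)^2$, $\mathcal{A}_{21}=\mathcal{A}_2+(\mathcal{A}_1-\alpha)q^{-2j_2}(T^{(2)}_+)^2$, $\mathcal{B}_{21}=\mathcal{B}_1+q^{2j_1}(T^{(1)}_-)^2(\mathcal{B}_2-\beta)$. A tridiagonal (TD) pair on a nonzero finite-dimensional complex space $V$ is an ordered pair $\mathsf{A},\mathsf{A}^*\in\mathrm{End}(V)$, both diagonalizable, with orderings $V_0,\dots,V_d$ and $V_0^*,\dots,V^*_\delta$ of their eigenspaces such that $\mathsf{A}^*V_p\subseteq V_{p-1}+V_p+V_{p+1}$ and $\mathsf{A}V^*_p\subseteq V^*_{p-1}+V^*_p+V^*_{p+1}$ (out-of-range spaces being $0$), and with no common invariant subspace other than $0$ and $V$. Under (i)–(iii), $(\mathcal{A}_{12},\mathcal{B}_{21})$ and $(\mathcal{A}_{21},\mathcal{B}_{12})$ are TD pairs. $q$-strings: $S(d,v)=\{vq^{2i-d+1}\mid 0\le i\le d-1\}$ for $v\in\mathbb{C}^*$, $d\in\mathbb{N}$. Two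 $q$-strings are in general position if either their union is not a $q$-string or one contains the other. In (iii) the exponents of $q$ run over consecutive integers.
   Formalization: Where a denominator in the formula for R_k(l;a,b,u,j,q) vanishes (possible for the shifted arguments under (i)–(iii), e.g. j1=j2=1/2, ab=q^3/u1^2), R is taken to be its limit in b; elsewhere it is the printed formula. *)

(* Defs.v *)
From HB Require Import structures.
From mathcomp Require Import all_boot all_order all_algebra polyXY.
From mathcomp Require Import all_classical all_reals all_analysis.
From mathcomp.real_closed Require Export complex.

Set Implicit Arguments.
Unset Strict Implicit.
Unset Printing Implicit Defensive.

Import Order.TTheory GRing.Theory Num.Theory numFieldNormedType.Exports.

Local Open Scope classical_set_scope.
Local Open Scope ring_scope.

(* Conventions.
   - A spin j in (1/2)N enters through the natural number m = 2j.
   - s is a square root of q and q^j is s ^+ m; integer powers are powers of q.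
   - C[z1] (x) C[z2] is {poly {poly K}}: the outer indeterminate is z1 and the
     coefficients are polynomials in z2. *)

Section QSeries.
Context {K : numFieldType}.
Implicit Types (Q z a b u v : K) (k l m n d : nat).

(* (x; y)_n, in any commutative ring: x may also be a polynomial. *)
Definition qpoch {A : comNzRingType} (x y : A) n : A :=
  \prod_(k < n) (1 - x * y ^+ k).

Definition qbinom Q n l : K :=
  qpoch Q Q n / (qpoch Q Q l * qpoch Q Q (n - l)).

(* Terminating 4phi3 in base Q with first upper parameter Q^{-n}. *)
Definition phi43 Q n (a1 a2 a3 b1 b2 b3 z : K) : K :=
  \sum_(k < n.+1)
    (qpoch (Q ^- n) Q k * qpoch a1 Q k * qpoch a2 Q k * qpoch a3 Q k)
    / (qpoch Q Q k * qpoch b1 Q k * qpoch b2 Q k * qpoch b3 Q k) * z ^+ k.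

Section Rcoef.
Variables (q : K) (m k l : nat) (a b u : K).

Definition Rcoef_formula : K :=
  q ^ (2 * l%:Z * (l%:Z - m%:Z)) * qbinom (q ^+ 2) m l
  * (qpoch (q ^ (2 - m%:Z) * a * b * u ^- 2) (q ^+ 2) l
     * qpoch (q ^ (2 - m%:Z) * a^-1 * b * u ^- 2) (q ^+ 2) (m - l)
     * qpoch (q ^ (2 + m%:Z - 2 * k%:Z) * a^-1 * b^-1 * u ^- 2) (q ^+ 2) k)
  / (qpoch (q ^ (2 * l%:Z - 2 * m%:Z) * a ^+ 2) (q ^+ 2) l
     * qpoch (q ^ (- 2 * l%:Z) * a ^- 2) (q ^+ 2) (m - l)
     * qpoch (q ^ (2 - m%:Z) * a^-1 * b * u ^- 2) (q ^+ 2) k)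
  * phi43 (q ^+ 2) k
      (q ^ (2 * k%:Z - 2 * m%:Z) * b ^+ 2)
      (q ^ (- 2 * l%:Z))
      (q ^ (2 * l%:Z - 2 * m%:Z) * a ^+ 2)
      (q ^ (- 2 * m%:Z))
      (q ^ (- m%:Z) * a * b * u ^+ 2)
      (q ^ (2 - m%:Z) * a * b * u ^- 2)
      (q ^+ 2).

(* No denominator of Rcoef_formula vanishes. *)
Definition Rcoef_defined : bool :=
  [&& qpoch (q ^+ 2) (q ^+ 2) l * qpoch (q ^+ 2) (q ^+ 2) (m - l) != 0,
      qpoch (q ^ (2 * l%:Z - 2 * m%:Z) * a ^+ 2) (q ^+ 2) l != 0,
      qpoch (q ^ (- 2 * l%:Z) * a ^- 2) (q ^+ 2) (m - l) != 0,
      qpoch (q ^ (2 - m%:Z) * a^-1 * b * u ^- 2) (q ^+ 2) k != 0,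
      qpoch (q ^+ 2) (q ^+ 2) k != 0,
      qpoch (q ^ (- 2 * m%:Z)) (q ^+ 2) k != 0,
      qpoch (q ^ (- m%:Z) * a * b * u ^+ 2) (q ^+ 2) k != 0 &
      qpoch (q ^ (2 - m%:Z) * a * b * u ^- 2) (q ^+ 2) k != 0].

End Rcoef.

(* R_k(l; a, b, u, m/2, q): the formula where it makes sense.  As a function of
   b it is rational; with the shifted arguments a q^i, b q^i' used below, some
   of its denominators can vanish even though those for a, b do not (e.g. for
   k > 0 when a b q^(i+i') u^2 = q^m).  These singularities in b are removable,
   and there R denotes the value extended by continuity. *)
Definition Rcoef q m k l a b u : K :=
  if Rcoef_defined q m k l a b u then Rcoef_formula q m k l a b u
  else lim (Rcoef_formula q m k l a b' u @[b' --> b^']).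

Definition not_root_of_unity (q : K) : Prop :=
  forall n, (0 < n)%N -> q ^+ n != 1.

Definition qstring (q : K) d v : set K :=
  [set x | exists2 i, (i < d)%N & x = v * q ^ (2 * i%:Z - d%:Z + 1)].

Definition is_qstring (q : K) (X : set K) : Prop :=
  exists d v, v != 0 /\ X = qstring q d v.

Definition general_position (q : K) (X Y : set K) : Prop :=
  ~ is_qstring q (X `|` Y) \/ (X `<=` Y \/ Y `<=` X).

End QSeries.

Section Operators.
Context {K : numFieldType}.
Implicit Types (a b u c : K) (f g h : {poly K}) (F : {poly {poly K}}).
Implicit Types (m n : nat).

Definition tens g h : {poly {poly K}} := map_poly polyC g * h%:P.

(* X (x) 1 and 1 (x) X for an operator X on C[z]. *)
Definition on2 (X : {poly K} -> {poly K}) F := map_poly X F.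
Definition on1 (X : {poly K} -> {poly K}) F := swapXY (map_poly X (swapXY F)).

(* C_{m1}[z1] (x) C_{m2}[z2] *)
Definition in_space m1 m2 F : Prop :=
  (size F <= m1.+1)%N /\ forall i, (size (F`_i)%R <= m2.+1)%N.

Definition is_basis m1 m2 (e : nat -> nat -> {poly {poly K}}) : Prop :=
  (forall n1 n2, (n1 <= m1)%N -> (n2 <= m2)%N -> in_space m1 m2 (e n1 n2)) /\
  (forall F, in_space m1 m2 F ->
     exists! c : {ffun 'I_m1.+1 * 'I_m2.+1 -> K},
       F = \sum_(i < m1.+1) \sum_(j < m2.+1) (c (i, j))%:P *: e i j).

Definition eigenbasis m1 m2 (X : {poly {poly K}} -> {poly {poly K}})
    (e : nat -> nat -> {poly {poly K}}) : Prop :=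
  is_basis m1 m2 e /\
  (forall n1 n2, (n1 <= m1)%N -> (n2 <= m2)%N ->
     exists t : K, X (e n1 n2) = t%:P *: e n1 n2).

(* The coefficients S k1 k2 l1 l2 of the eigenbasis w of Y on the
   eigenbasis e of X. *)
Definition overlap_coefficients m1 m2
    (X Y : {poly {poly K}} -> {poly {poly K}})
    (e w : nat -> nat -> {poly {poly K}}) (S : nat -> nat -> nat -> nat -> K) :=
  [/\ eigenbasis m1 m2 X e, eigenbasis m1 m2 Y w &
      forall k1 k2, (k1 <= m1)%N -> (k2 <= m2)%N ->
        w k1 k2 =
        \sum_(l1 < m1.+1) \sum_(l2 < m2.+1) (S k1 k2 l1 l2)%:P *: e l1 l2].

(* p_n(c z; a, m/2, r) *)
Definition pbasis n c a m (r : K) : {poly K} :=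
  qpoch ((c * a) *: 'X) ((r ^+ 2)%:P) n
  * qpoch ((c / a) *: 'X) ((r ^+ 2)%:P) (m - n).

Variables (q s : K).

Definition T_plus f : {poly K} := f \Po (q *: 'X).
Definition T_minus f : {poly K} := f \Po (q^-1 *: 'X).

(* z^{-1} f, for f without constant term (drop_poly 1 is exact there). In the
   operators below z^{-1} is factored out so that it only acts on such f. *)
Definition divX f : {poly K} := drop_poly 1 f.

Definition opA m a u f : {poly K} :=
  (u * s ^+ m) *: ('X * f)
  + divX ((u^-1 * s ^- m) *: f
          - (u^-1 * s ^- m) *:
              ((1 - (u * s ^- m * a) *: 'X) * (1 - (u * s ^- m * a^-1) *: 'X)
               * T_plus (T_plus f))).

Definition opB m b u f : {poly K} :=
  (u^-1 * s ^- m) *: ('X * f)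
  + divX ((u * s ^+ m) *: f
          - (u * s ^+ m) *:
              ((1 - (u^-1 * s ^+ m * b) *: 'X)
               * (1 - (u^-1 * s ^+ m * b^-1) *: 'X)
               * T_minus (T_minus f))).

Variables (m1 m2 : nat) (a b u1 u2 : K).

Let Tp2 f := T_plus (T_plus f).
Let Tm2 f := T_minus (T_minus f).
Let A1 := on1 (opA m1 a u1).
Let A2 := on2 (opA m2 a u2).
Let B1 := on1 (opB m1 b u1).
Let B2 := on2 (opB m2 b u2).
Let alpha : {poly K} := (a + a^-1)%:P.
Let beta : {poly K} := (b + b^-1)%:P.

Definition opA12 F := A1 F + (q ^- m1)%:P *: on1 Tp2 (A2 F - alpha *: F).
Definition opB12 F :=
  B2 F + (q ^+ m2)%:P *: (B1 (on2 Tm2 F) - beta *: on2 Tm2 F).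
Definition opA21 F :=
  A2 F + (q ^- m2)%:P *: (A1 (on2 Tp2 F) - alpha *: on2 Tp2 F).
Definition opB21 F := B1 F + (q ^+ m1)%:P *: on1 Tm2 (B2 F - beta *: F).

Definition ubasis n1 n2 :=
  tens (pbasis n1 (u1 * s ^- m1) (a * q ^ (2 * n2%:Z - m2%:Z)) m1 q)
       (pbasis n2 (u2 * s ^- m2) a m2 q).

Definition wbasis n1 n2 :=
  tens (pbasis n1 (s ^+ m1 * u1^-1) b^-1 m1 q^-1)
       (pbasis n2 (s ^+ m2 * u2^-1) (b^-1 * q ^ (m1%:Z - 2 * n1%:Z)) m2 q^-1).

Definition ubarbasis n1 n2 :=
  tens (pbasis n1 (u1 * s ^- m1) a m1 q)
       (pbasis n2 (u2 * s ^- m2) (a * q ^ (2 * n1%:Z - m1%:Z)) m2 q).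

Definition wbarbasis n1 n2 :=
  tens (pbasis n1 (s ^+ m1 * u1^-1) (b^-1 * q ^ (m2%:Z - 2 * n2%:Z)) m1 q^-1)
       (pbasis n2 (s ^+ m2 * u2^-1) b^-1 m2 q^-1).

Definition Scoef k1 k2 l1 l2 : K :=
  Rcoef q m1 k1 l1 (a * q ^ (2 * l2%:Z - m2%:Z)) (b * q ^ (2 * k2%:Z - m2%:Z)) u1
  * Rcoef q m2 k2 l2 a b u2.

Definition Sbarcoef k1 k2 l1 l2 : K :=
  Rcoef q m1 k1 l1 a b u1
  * Rcoef q m2 k2 l2 (a * q ^ (2 * l1%:Z - m1%:Z)) (b * q ^ (2 * k1%:Z - m1%:Z))
      u2.

End Operators.

(* Main.v *)
Require Import Defs.
From mathcomp Require Import all_boot all_order all_algebra polyXY.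
From mathcomp Require Import all_classical all_reals all_analysis.
From mathcomp.real_closed Require Import complex.
From mathcomp Require Import ring zify.

(* By the tensor structure of the four bases, everything reduces to one
   variable: (w1 z; Q^-1)_k (w2 z; Q^-1)_(m-k) has to be expanded in the basis
   (al z; Q)_l (be z; Q)_(m-l), with Q = q^2.  Splitting each linear factor as
   a combination of 1 - al Q^l z and 1 - be Q'^p z gives a Pascal-type
   recursion for expansion coefficients.  Solving it in two special cases
   expands (w1 z; Q^-1)_k in (al z; Q)_i (be' z; Q^-1)_(k-i), a q-Saalschuetz
   sum, and then (w2 z; Q^-1)_(m-i) in the target basis, a q-Vandermonde sum;
   composing the two produces the 4phi3.  The recursion itself involves b only
   through the linear factors, so the coefficients are continuous in b and
   agree with the limits used in Rcoef.  The operators B are the operators A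
   with q, b, u replaced by their inverses. *)

Set Implicit Arguments.
Unset Strict Implicit.
Unset Printing Implicit Defensive.

Import Order.TTheory GRing.Theory Num.Theory numFieldNormedType.Exports.

Local Open Scope classical_set_scope.
Local Open Scope ring_scope.

(** * The q-shifted factorials *)

Section QPochhammer.
Variable A : comNzRingType.
Implicit Types x y : A.

Lemma qpoch0 x y : qpoch x y 0 = 1.
Proof. by rewrite /qpoch big_ord0. Qed.

Lemma qpochS x y n : qpoch x y n.+1 = qpoch x y n * (1 - x * y ^+ n).
Proof. by rewrite /qpoch big_ord_recr. Qed.

Lemma qpochD x y m n : qpoch x y (m + n) = qpoch x y m * qpoch (x * y ^+ m) y n.
Proof.
rewrite /qpoch big_split_ord /=; congr (_ * _).
by apply: eq_bigr => i _; rewrite -mulrA -exprD.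
Qed.

Lemma qpochSl x y n : qpoch x y n.+1 = (1 - x) * qpoch (x * y) y n.
Proof. by rewrite -add1n qpochD /qpoch big_ord1 expr0 mulr1 expr1. Qed.

End QPochhammer.

(** Listing the factors in reverse order turns base [1/y] into base [y], with the last node as the
    new first one. *)
Lemma qpoch_rev (F : fieldType) (x y : F) n : y != 0 ->
  qpoch x y^-1 n = qpoch (x * y ^ (1 - n%:Z)) y n.
Proof.
move=> y0; rewrite /qpoch (reindex_inj rev_ord_inj) /=.
apply: eq_bigr => i _; congr (1 - _); rewrite -mulrA; congr (_ * _).
rewrite exprVn exprnN [y ^+ i]exprnP -expfzDr //; congr (_ ^ _).
have := ltn_ord i; lia.
Qed.

(** * Expansion coefficients by a Pascal recursion *)

Section PascalExpansion.
Variables (F : fieldType) (al be Q Q' : F).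

Definition pair_basis l p : {poly F} :=
  qpoch (al *: 'X) Q%:P l * qpoch (be *: 'X) Q'%:P p.

Definition node_gap l p := al * Q ^+ l - be * Q' ^+ p.

Section Coefficients.
Variables x0 x1 : nat -> F.

(* x0 - x1 z = wl (1 - al Q^l z) + wr (1 - be Q'^p z). *)
Definition wl l p := (x1 (l + p)%N - x0 (l + p)%N * (be * Q' ^+ p)) / node_gap l p.
Definition wr l p := (x0 (l + p)%N * (al * Q ^+ l) - x1 (l + p)%N) / node_gap l p.

(** [pascal l p] is the coefficient of [pair_basis l p] in the product of the first [l + p] factors
    [x0 i - x1 i z]; an antidiagonal of this table is one row of the triangle. Each call lowers one
    of the two indices, hence the nested [fix]. *)
Fixpoint pascal l : nat -> F :=
  fix row p :=
    if l is l'.+1 then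
      if p is p'.+1 then wl l' p * pascal l' p + wr l p' * row p'
      else wl l' 0 * pascal l' 0
    else if p is p'.+1 then wr 0 p' * row p' else 1.

Lemma pascal_expand n :
  (forall l p, (l + p < n)%N -> node_gap l p != 0) ->
  \prod_(i < n) ((x0 i)%:P - x1 i *: 'X) =
  \sum_(l < n.+1) pascal l (n - l) *: pair_basis l (n - l).
Proof.
elim: n => [|n IHn] gap.
  by rewrite big_ord0 big_ord1 /= subn0 /pair_basis !qpoch0 mulr1 scale1r.
(* [L] and [R] split an entry by the basis factor appended last, with value 0 where that factor is
   absent. Dropping these zero terms leaves two sums over the same [n.+1] indices. *)
pose L l p := if l is l'.+1 then wl l' p * pascal l' p else 0.
pose R l p := if p is p'.+1 then wr l p' * pascal l p' else 0.
have pascalE l p : (0 < l + p)%N -> pascal l p = L l p + R l p.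
  by case: l p => [|l] [|p] //= _; rewrite ?add0r ?addr0.
rewrite big_ord_recr /= IHn => [|l p lt_lp]; last by apply: gap; lia.
rewrite mulr_suml.
rewrite [RHS](eq_bigr (fun l : 'I_n.+2 =>
    L l (n.+1 - l)%N *: pair_basis l (n.+1 - l)
  + R l (n.+1 - l)%N *: pair_basis l (n.+1 - l))); last first.
  by move=> l _; rewrite -scalerDl -pascalE //; have := ltn_ord l; lia.
rewrite big_split /= [X in _ = X + _]big_ord_recl /= scale0r add0r.
rewrite [X in _ = _ + X]big_ord_recr /= subnn scale0r addr0 -big_split /=.
apply: eq_bigr => l _; have ltl := ltn_ord l.
rewrite /bump /= add1n subSS subSn //=.
rewrite ![wl _ _ * _]mulrC ![wr _ _ * _]mulrC.
rewrite -![(pascal _ _ * _) *: _]scalerA -scalerAl -scalerDr.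
congr (_ *: _).
have g0 : node_gap l (n - l) != 0 by apply: gap; lia.
rewrite /pair_basis !qpochS -!mul_polyC.
have e0 : x0 n = wl l (n - l) + wr l (n - l).
  by move: g0; rewrite /wl /wr subnKC // /node_gap => g0; field.
have e1 : x1 n = wl l (n - l) * (al * Q ^+ l) + wr l (n - l) * (be * Q' ^+ (n - l)).
  by move: g0; rewrite /wl /wr subnKC // /node_gap => g0; field.
rewrite ?add0n e0 e1; move: (wl _ _) (wr _ _) => A B; rewrite !polyCD !polyCM !polyC_exp.
by ring.
Qed.

(** The recursion determines its solution, so a closed form needs only the boundary rules and one
    interior identity. The bound [n] is carried along because denominators are known to be nonzero
    only up to that degree. *)
Lemma pascal_unique (D : nat -> nat -> F) n :
  D 0 0 = 1 ->
  (forall p, (p < n)%N -> D 0 p.+1 = wr 0 p * D 0 p) ->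
  (forall l, (l < n)%N -> D l.+1 0 = wl l 0 * D l 0) ->
  (forall l p, ((l + p).+1 < n)%N ->
     D l.+1 p.+1 = wl l p.+1 * D l p.+1 + wr l.+1 p * D l.+1 p) ->
  forall l p, (l + p <= n)%N -> pascal l p = D l p.
Proof.
move=> D00 D0 Dl D1; elim=> [|l IHl]; elim=> [|p IHp] lep.
- by rewrite D00.
- by rewrite D0 -?IHp //; lia.
- by rewrite Dl -?IHl //; lia.
- by rewrite D1 -?IHl -?IHp //; lia.
Qed.

End Coefficients.
End PascalExpansion.

Lemma subr_neq0C (V : zmodType) (x y : V) : (x - y != 0) = (y - x != 0).
Proof. by rewrite -oppr_eq0 opprB. Qed.

(** For the side conditions of [field]: each one is matched with a nonvanishing hypothesis up to
    ring normalisation and sign. *)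
Ltac nonzero :=
  repeat (apply/andP; split); try assumption;
  match goal with g : is_true (?e != 0) |- is_true (?f != 0) =>
    first [have -> : f = e by ring | have -> : f = - e by ring];
    rewrite ?oppr_eq0; exact: g
  end.

(* The homogeneous form of the q-shifted factorial avoids divisions by
   parameters that may vanish. *)
Definition hpoch (A : comNzRingType) (x y Q : A) n := \prod_(r < n) (x - y * Q ^+ r).

Section Hpoch.
Variable F : fieldType.
Implicit Types x y Q : F.

Lemma hpoch0 x y Q : hpoch x y Q 0 = 1.
Proof. by rewrite /hpoch big_ord0. Qed.

Lemma hpochS x y Q n : hpoch x y Q n.+1 = hpoch x y Q n * (x - y * Q ^+ n).
Proof. by rewrite /hpoch big_ord_recr. Qed.

Lemma hpochSl x y Q n : hpoch x y Q n.+1 = (x - y) * hpoch x (y * Q) Q n.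
Proof.
rewrite /hpoch big_ord_recl /= expr0 mulr1; congr (_ * _).
by apply: eq_bigr => i _; rewrite exprS mulrA.
Qed.

Lemma hpochZ c x y Q n : hpoch (c * x) (c * y) Q n = c ^+ n * hpoch x y Q n.
Proof.
elim: n => [|n IHn]; first by rewrite !hpoch0 mulr1.
by rewrite !hpochS IHn exprS; ring.
Qed.

Lemma hpoch_neq0 x y Q n :
  (forall r, (r < n)%N -> x - y * Q ^+ r != 0) -> hpoch x y Q n != 0.
Proof. by move=> nz; apply/prodf_neq0 => r _; apply: nz. Qed.

Lemma hpochE x y Q n : x != 0 -> hpoch x y Q n = x ^+ n * qpoch (y / x) Q n.
Proof.
move=> x0; elim: n => [|n IHn]; first by rewrite hpoch0 qpoch0 mulr1.
by rewrite hpochS qpochS IHn exprS; field.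
Qed.

End Hpoch.

(** * Closed solutions of the recursion *)

Section ClosedForms.
Variable F : fieldType.
Variables (al be Q : F).

Definition qbin l p := qpoch Q Q (l + p) / (qpoch Q Q l * qpoch Q Q p).

(** The coefficient of [(al z; Q)_l (be z; Q)_p] in [(t z; Q)_(l+p)]. *)
Definition vandermonde t l p :=
  qbin l p * Q ^+ (l * p) * (hpoch be t Q l * hpoch al t Q p)
  / (hpoch (Q ^+ p * be) al Q l * hpoch (Q ^+ l * al) be Q p).

(** The coefficient of [(al z; Q)_l (be z; 1/Q)_p] in [(s z; Q)_(l+p)]. With opposite bases the gap
    is [Q^l (al - be Q^-(l+p))], which up to a power of [Q] depends on [l + p] only; hence the
    single product in the denominator. *)
Definition saalschutz s l p :=
  qbin l p * (hpoch al s Q p * hpoch s (be * Q^-1 ^+ p) Q^-1 l)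
  / hpoch al be Q^-1 (l + p).

Lemma pascal_vandermonde t n : Q != 0 ->
  (forall l, (l <= n)%N -> qpoch Q Q l != 0) ->
  (forall l p, (l + p < n)%N -> node_gap al be Q Q l p != 0) ->
  forall l p, (l + p <= n)%N ->
  pascal al be Q Q (fun=> 1) (fun i => t * Q ^+ i) l p = vandermonde t l p.
Proof.
move=> Q0 Qn0 gap; apply: pascal_unique; rewrite /vandermonde /qbin.
- by rewrite addn0 muln0 !hpoch0 !qpoch0 expr0; field; rewrite oner_neq0.
- move=> p lt_p; have := gap 0 p lt_p.
  rewrite /wr /node_gap !add0n !expr0 !mul1r ?mul0n !hpoch0 qpoch0 !hpochS.
  have h : hpoch al be Q p != 0.
    apply: hpoch_neq0 => r ltr; have := gap 0 r; rewrite /node_gap expr0 mulr1.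
    by apply; lia.
  have q1 := Qn0 p.+1 lt_p; have q0 := Qn0 p (ltnW lt_p).
  by move=> g; field; rewrite h q0 q1; move: g; rewrite mulr1 => ->.
- move=> l lt_l; have := gap l 0; rewrite addn0 => /(_ lt_l).
  rewrite /wl /node_gap !addn0 !expr0 !mul1r !muln0 !mulr1 !hpoch0 qpoch0 !hpochS.
  have h : hpoch be al Q l != 0.
    apply: hpoch_neq0 => r ltr; have := gap r 0; rewrite /node_gap expr0 mulr1.
    by rewrite subr_neq0C; apply; lia.
  have q1 := Qn0 l.+1 lt_l; have q0 := Qn0 l (ltnW lt_l).
  by move=> g; field; rewrite h q0 q1 g subr_neq0C g.
- move=> l p ltlp.
  have g00 := gap l p ltac:(lia); have g10 := gap l.+1 p ltac:(lia).
  have g01 := gap l p.+1 ltac:(lia).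
  (* These two gaps are, up to sign, the leading factors split off in [Xe] and [Ye]. *)
  have g1 := gap l.+1 0 ltac:(lia); have g2 := gap 0 p.+1 ltac:(lia).
  have ql := Qn0 l.+1 ltac:(lia); have qp := Qn0 p.+1 ltac:(lia).
  have ql0 := Qn0 l ltac:(lia); have qp0 := Qn0 p ltac:(lia).
  have X0 : hpoch (Q ^+ p * be) al Q l != 0.
    apply: hpoch_neq0 => r ltr; have := gap r p ltac:(lia).
    by rewrite /node_gap subr_neq0C [be * _]mulrC.
  have Y0 : hpoch (Q ^+ l * al) be Q p != 0.
    apply: hpoch_neq0 => r ltr; have := gap l r ltac:(lia).
    by rewrite /node_gap [al * _]mulrC.
  (* The three entries of the interior recursion have different denominators. All are written
     through the two products at [(l, p)], which leaves a rational identity with [Q ^+ l] and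
     [Q ^+ p] as independent variables. *)
  have Xe : hpoch (Q ^+ p.+1 * be) al Q l.+1
      = (Q ^+ p.+1 * be - al) * (Q ^+ l * hpoch (Q ^+ p * be) al Q l).
    by rewrite hpochSl -hpochZ exprS -mulrA [al * Q]mulrC.
  have Ye : hpoch (Q ^+ l.+1 * al) be Q p.+1
      = (Q ^+ l.+1 * al - be) * (Q ^+ p * hpoch (Q ^+ l * al) be Q p).
    by rewrite hpochSl -hpochZ exprS -mulrA [be * Q]mulrC.
  have Xe' : hpoch (Q ^+ p.+1 * be) al Q l = (Q ^+ p.+1 * be - al) *
      (Q ^+ l * hpoch (Q ^+ p * be) al Q l) / (Q ^+ p.+1 * be - al * Q ^+ l).
    rewrite -Xe hpochS mulfK //.
    by move: g01; rewrite /node_gap subr_neq0C [be * _]mulrC.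
  have Ye' : hpoch (Q ^+ l.+1 * al) be Q p = (Q ^+ l.+1 * al - be) *
      (Q ^+ p * hpoch (Q ^+ l * al) be Q p) / (Q ^+ l.+1 * al - be * Q ^+ p).
    rewrite -Ye hpochS mulfK //.
    by move: g10; rewrite /node_gap [al * _]mulrC.
  rewrite Xe Ye Xe' Ye' (hpochS _ _ _ l) (hpochS _ _ _ p) !hpochS.
  move: (hpoch (Q ^+ p * be) al Q l) (hpoch (Q ^+ l * al) be Q p) X0 Y0 => X Y X0 Y0.
  move: g00 g01 g10 g1 g2 ql qp ql0 qp0.
  rewrite /wl /wr /node_gap !addSn !addnS !qpochS !mulnS !mulSn !exprD !exprS !expr0 !mulr1 ?exprD.
  have xn0 : Q ^+ l != 0 by rewrite expf_neq0.
  have yn0 : Q ^+ p != 0 by rewrite expf_neq0.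
  move: (qpoch Q Q (l + p)) (qpoch Q Q l) (qpoch Q Q p) => G Gl Gp.
  move: (Q ^+ (l * p)) (Q ^+ l) (Q ^+ p) xn0 yn0 => w x y x0 y0.
  move: (hpoch be t Q l) (hpoch al t Q p) => U V.
  move=> g00 g01 g10 g1 g2 ql qp ql0 qp0.
  have [ql1 qp1] : 1 - Q * x != 0 /\ 1 - Q * y != 0.
    by move: ql qp; rewrite !mulf_eq0 !negb_or => /andP[_ ->] /andP[_ ->].
  by field; nonzero.
Qed.

End ClosedForms.

(** * The solution for opposite bases, and ratios of terms *)

Section ClosedFormRatios.
Variable F : fieldType.
Variables (al be Q : F).
Local Notation saalschutz := (saalschutz al be Q).

Lemma pascal_saalschutz s n : Q != 0 ->
  (forall l, (l <= n)%N -> qpoch Q Q l != 0) ->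
  (forall r, (r < n)%N -> al - be * Q^-1 ^+ r != 0) ->
  forall l p, (l + p <= n)%N ->
  pascal al be Q Q^-1 (fun=> 1) (fun i => s * Q ^+ i) l p = saalschutz s l p.
Proof.
move=> Q0 Qn0 gap; apply: pascal_unique; rewrite /saalschutz /qbin.
- by rewrite addn0 !hpoch0 !qpoch0; field; rewrite oner_neq0.
- move=> p lt_p; have := gap p lt_p.
  rewrite /wr /node_gap !add0n !expr0 !mul1r !hpoch0 qpoch0 !hpochS.
  have h : hpoch al be Q^-1 p != 0.
    by apply: hpoch_neq0 => r ltr; apply: gap; lia.
  have q1 := Qn0 p.+1 lt_p; have q0 := Qn0 p (ltnW lt_p).
  by move=> g; field; rewrite h q0 q1; move: g; rewrite ?mulr1 => ->.
- move=> l lt_l; have := gap l lt_l.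
  rewrite /wl /node_gap !addn0 !expr0 !mul1r !mulr1 !hpoch0 qpoch0 !hpochS.
  have h : hpoch al be Q^-1 l != 0.
    by apply: hpoch_neq0 => r ltr; apply: gap; lia.
  have q1 := Qn0 l.+1 lt_l; have q0 := Qn0 l (ltnW lt_l).
  rewrite exprVn => g.
  have x0 : Q ^+ l != 0 by rewrite expf_neq0.
  have g' : al * Q ^+ l - be != 0.
    have -> : al * Q ^+ l - be = (al - be / Q ^+ l) * Q ^+ l by field.
    by rewrite mulf_neq0.
  by field; nonzero.
- move=> l p ltlp.
  have := gap (l + p).+1 ltac:(lia).
  have ql := Qn0 l.+1 ltac:(lia); have qp := Qn0 p.+1 ltac:(lia).
  have ql0 := Qn0 l ltac:(lia); have qp0 := Qn0 p ltac:(lia).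
  have Z0 : hpoch al be Q^-1 (l + p).+1 != 0.
    by apply: hpoch_neq0 => r ltr; apply: gap; lia.
  have eQ : be * Q^-1 ^+ p * Q^-1 = be * Q^-1 ^+ p.+1 by rewrite exprSr mulrA.
  rewrite [in RHS](hpochSl s (be * Q^-1 ^+ p)) eQ (hpochS _ _ _ l) (hpochS _ _ _ p).
  rewrite !addSn !addnS (hpochS _ _ _ (l + p).+1).
  move: (hpoch _ _ _ (l + p).+1) Z0 => Z Z0.
  move: (hpoch s _ _ _) (hpoch _ _ _ _) => X Y.
  move: ql qp ql0 qp0.
  rewrite /wl /wr /node_gap !addSn !addnS !qpochS !exprVn !exprS !exprD.
  have xn0 : Q ^+ l != 0 by rewrite expf_neq0.
  have yn0 : Q ^+ p != 0 by rewrite expf_neq0.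
  move: (qpoch Q Q (l + p)) (qpoch Q Q l) (qpoch Q Q p) => G Gl Gp.
  move: (Q ^+ l) (Q ^+ p) xn0 yn0 => x y x0 y0.
  move=> ql qp ql0 qp0 g.
  have [ql1 qp1] : 1 - Q * x != 0 /\ 1 - Q * y != 0.
    by move: ql qp; rewrite !mulf_eq0 !negb_or => /andP[_ ->] /andP[_ ->].
  have g0 : al * (Q * (x * y)) - be != 0.
    have -> : al * (Q * (x * y)) - be = (al - be / (Q * (x * y))) * (Q * (x * y)).
      by field; nonzero.
    by rewrite !mulf_neq0.
  by field; nonzero.
Qed.

(** This first term of the composed sum becomes a prefactor of the 4phi3. *)
Lemma saalschutz0 s k : Q != 0 -> al != 0 -> qpoch Q Q k != 0 ->
  saalschutz s 0 k = qpoch (s / al) Q k / qpoch (be / al * Q ^ (1 - k%:Z)) Q k.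
Proof.
move=> Q0 al0 Qk; rewrite /saalschutz /qbin add0n hpoch0 qpoch0 !hpochE //.
rewrite qpoch_rev // mul1r mulr1 divff // mul1r -mulf_div divff ?mul1r //.
by rewrite expf_neq0.
Qed.

Lemma vandermondeE t l p : Q != 0 -> al != 0 -> be != 0 ->
  vandermonde al be Q t l p =
  Q ^- (l * p) * qbin Q l p * (qpoch (t / be) Q l * qpoch (t / al) Q p)
  / (qpoch (Q ^- p * (al / be)) Q l * qpoch (Q ^- l * (be / al)) Q p).
Proof.
move=> Q0 al0 be0.
have pw n : Q ^+ n != 0 by rewrite expf_neq0.
rewrite /vandermonde !hpochE ?mulf_neq0 //.
have -> : al / (Q ^+ p * be) = Q ^- p * (al / be) by rewrite invfM mulrCA.
have -> : be / (Q ^+ l * al) = Q ^- l * (be / al) by rewrite invfM mulrCA.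
rewrite !exprMn -!exprM [in (p * l)%N]mulnC.
move: (qpoch _ _ _) (qpoch _ _ _) (qpoch _ _ _) (qpoch _ _ _) => A B C D.
rewrite !invfM; move: A^-1 B^-1 => A' B'.
have := pw (l * p)%N; have := expf_neq0 l be0; have := expf_neq0 p al0.
move: (Q ^+ (l * p)) (be ^+ l) (al ^+ p) => x y z z0 y0 x0.
by field; nonzero.
Qed.

(** For fixed [l + p] the quotient of consecutive entries is rational in [Q ^+ l], so the entries
    are the terms of a basic hypergeometric series with first term [saalschutz s 0 (l + p)]. *)
Lemma saalschutz_ratio (s : F) l p : Q != 0 -> s != 0 ->
  (forall i, (i <= l + p)%N -> qpoch Q Q i != 0) ->
  qpoch (al / s * Q ^ (1 - (l + p)%N%:Z)) Q l != 0 ->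
  saalschutz s l p = saalschutz s 0 (l + p) *
  ((qpoch (Q ^- (l + p)) Q l * qpoch (be / s * Q ^ (1 - (l + p)%N%:Z)) Q l)
   / (qpoch Q Q l * qpoch (al / s * Q ^ (1 - (l + p)%N%:Z)) Q l) * Q ^+ l).
Proof.
move=> Q0 s0; elim: l p => [|l IHl] p Qn0 nz.
  by rewrite !qpoch0 !mulr1 divr1 mulr1.
rewrite addSnnS in nz Qn0 *; move: nz; rewrite !qpochS mulf_eq0 negb_or => /andP[nz nz1].
have -> : saalschutz s l.+1 p = saalschutz s l p.+1 *
   ((1 - Q ^- (l + p.+1) * Q ^+ l) * (1 - be / s * Q ^ (1 - (l + p.+1)%N%:Z) * Q ^+ l)
   / ((1 - Q * Q ^+ l) * (1 - al / s * Q ^ (1 - (l + p.+1)%N%:Z) * Q ^+ l)) * Q).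
  move: nz1; rewrite /saalschutz /qbin addSnnS (hpochS al s) (hpochSl s).
  have eQ : be * Q^-1 ^+ p * Q^-1 = be * Q^-1 ^+ p.+1 by rewrite exprSr mulrA.
  rewrite eQ !qpochS.
  have ql := Qn0 l.+1 ltac:(lia); have qp := Qn0 p.+1 ltac:(lia).
  have ql0 := Qn0 l ltac:(lia); have qp0 := Qn0 p ltac:(lia).
  move: ql qp; rewrite !qpochS !mulf_eq0 !negb_or => /andP[_ ql1] /andP[_ qp1].
  move: (hpoch _ _ _ _) (hpoch _ _ _ _) (hpoch _ _ _ _)^-1 => X Y Z.
  move: (qpoch Q Q (l + p.+1)) (qpoch Q Q l) (qpoch Q Q p) ql0 qp0 => G Gl Gp.
  move=> ql0 qp0.
  have -> : Q ^ (1 - (l + p.+1)%N%:Z) = (Q ^+ l * Q ^+ p)^-1.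
    by rewrite -exprD exprnN; congr (_ ^ _); lia.
  rewrite addnS exprS exprD exprVn.
  have xn0 : Q ^+ l != 0 by rewrite expf_neq0.
  have yn0 : Q ^+ p != 0 by rewrite expf_neq0.
  move: ql1 qp1.
  move: (Q ^+ l) (Q ^+ p) xn0 yn0 => x y x0 y0 ql1 qp1 nz1.
  have h : al - s * y != 0.
    have -> : al - s * y = - (s * y) * (1 - al / s / (x * y) * x) by field; nonzero.
    by rewrite !(mulf_neq0, oppr_eq0).
  by field; nonzero.
by rewrite IHl // exprSr !invfM; ring.
Qed.

(** The induction moves one power of [Q] at a time from [al] and [t] into the first index. When
    [l + i] is held fixed, the unshifted entry on the right is independent of [i] and can leave a
    sum over [i]. *)
Lemma vandermonde_ratio t i l p : Q != 0 -> be != 0 ->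
  (forall r, (r <= l + i + p)%N -> qpoch Q Q r != 0) ->
  (forall r, (r < l + i)%N -> Q ^+ p * be - al * Q ^+ r != 0) ->
  hpoch (Q ^+ (l + i) * al) be Q p != 0 ->
  qpoch (t / be) Q i != 0 ->
  vandermonde (al * Q ^+ i) be Q (t * Q ^+ i) l p =
  vandermonde al be Q t (l + i) p *
  ((qpoch (Q ^- (l + i)) Q i * qpoch (Q ^- p * (al / be)) Q i)
   / (qpoch (Q ^- (l + i + p)) Q i * qpoch (t / be) Q i)).
Proof.
move=> Q0 be0; elim: i l => [|i IHi] l Qn0 g g' nz.
  by rewrite !expr0 !qpoch0 !mulr1 divr1 mulr1 addn0.
rewrite addnS -addSn in Qn0 g g' *.
move: nz; rewrite !qpochS mulf_eq0 negb_or => /andP[nz nz1].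
have -> : vandermonde (al * Q ^+ i.+1) be Q (t * Q ^+ i.+1) l p =
   vandermonde (al * Q ^+ i) be Q (t * Q ^+ i) l.+1 p *
   ((1 - Q ^- (l.+1 + i) * Q ^+ i) * (1 - Q ^- p * (al / be) * Q ^+ i)
   / ((1 - Q ^- (l.+1 + i + p) * Q ^+ i) * (1 - t / be * Q ^+ i))).
  have qm := Qn0 (l.+1 + i + p)%N ltac:(lia).
  have gi := g i ltac:(lia).
  have eA : hpoch (al * Q ^+ i.+1) (t * Q ^+ i.+1) Q p
          = Q ^+ p * hpoch (al * Q ^+ i) (t * Q ^+ i) Q p.
    by rewrite -hpochZ exprS; congr hpoch; ring.
  have eT : t * Q ^+ i.+1 = t * Q ^+ i * Q by rewrite exprSr mulrA.
  have eL : al * Q ^+ i.+1 = al * Q ^+ i * Q by rewrite exprSr mulrA.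
  have eB : Q ^+ l * (al * Q ^+ i * Q) = Q ^+ l.+1 * (al * Q ^+ i) by rewrite exprS; ring.
  rewrite /vandermonde eA eL eB eT /qbin !(hpochSl _ _ _ l) !addSn !mulSn !exprD !exprS.
  have ql := Qn0 l.+1 ltac:(lia); have qp := Qn0 p ltac:(lia).
  have ql0 := Qn0 l ltac:(lia); have qlp := Qn0 (l + p).+1 ltac:(lia).
  move: ql qlp; rewrite !qpochS !mulf_eq0 !negb_or !exprD => /andP[_ ql1] /andP[qlp ql2].
  have xn0 : Q ^+ l != 0 by rewrite expf_neq0.
  have yn0 : Q ^+ p != 0 by rewrite expf_neq0.
  have zn0 : Q ^+ i != 0 by rewrite expf_neq0.
  move: (hpoch (Q ^+ p * be) _ Q l) (hpoch (_ * (al * _)) be Q p) => D1 D2.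
  rewrite [(D1 * D2)^-1]invfM [(_ * D1 * D2)^-1]invfM [(_ * D1)^-1]invfM.
  move: D1^-1 D2^-1 (hpoch _ _ _ _) (hpoch _ _ _ _) => D3 D4 X Y.
  move: qp ql0 ql1 qlp ql2 xn0 yn0 zn0 gi nz1.
  move: (qpoch Q Q (l + p)) (qpoch Q Q l) (qpoch Q Q p) => G Gl Gp.
  move: (Q ^+ (l * p)) (Q ^+ l) (Q ^+ p) (Q ^+ i) => w x y z.
  move=> qp ql0 ql1 qlp ql2 xn0 yn0 zn0 gi nz1.
  have h : be - t * z != 0.
    have -> : be - t * z = be * (1 - t / be * z) by field.
    by rewrite mulf_neq0.
  by field; nonzero.
by rewrite IHi // !invfM; ring.
Qed.

End ClosedFormRatios.

(** * Composition into the 4phi3 *)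

Section Connection.
Variable F : fieldType.
Implicit Types al be w t x y Q : F.

Lemma qpoch_scaleX x y n :
  qpoch (x *: 'X) y%:P n = \prod_(i < n) (1%:P - (x * y ^+ i) *: 'X) :> {poly F}.
Proof.
by apply: eq_bigr => i _; rewrite -!mul_polyC polyCM polyC_exp; congr (_ - _); ring.
Qed.

Lemma qpoch_scaleXD x y m n :
  qpoch (x *: 'X) y%:P (m + n) =
  qpoch (x *: 'X) y%:P m * qpoch ((x * y ^+ m) *: 'X) y%:P n :> {poly F}.
Proof.
by rewrite qpochD -!mul_polyC polyCM polyC_exp [_ * 'X * _]mulrAC.
Qed.

Lemma qpoch_scaleX_rev x y n : y != 0 ->
  qpoch (x *: 'X) y^-1%:P n = qpoch ((x * y ^ (1 - n%:Z)) *: 'X) y%:P n :> {poly F}.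
Proof.
move=> y0; rewrite !qpoch_scaleX (reindex_inj rev_ord_inj) /=.
apply: eq_bigr => i _; congr (_ - _ *: _); rewrite -mulrA; congr (_ * _).
rewrite exprVn exprnN [y ^+ i]exprnP -expfzDr //; congr (_ ^ _).
have := ltn_ord i; lia.
Qed.

Lemma vandermonde_expand al be t Q n : Q != 0 ->
  (forall l, (l <= n)%N -> qpoch Q Q l != 0) ->
  (forall l p, (l + p < n)%N -> node_gap al be Q Q l p != 0) ->
  qpoch (t *: 'X) Q%:P n =
  \sum_(l < n.+1) vandermonde al be Q t l (n - l) *: pair_basis al be Q Q l (n - l).
Proof.
move=> Q0 Qn0 gap; rewrite qpoch_scaleX.
rewrite (pascal_expand (fun=> 1) (fun i => t * Q ^+ i) gap).
apply: eq_bigr => l _; rewrite (pascal_vandermonde t Q0 Qn0 gap) //.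
by have := ltn_ord l; lia.
Qed.

Lemma saalschutz_expand al be s Q n : Q != 0 ->
  (forall l, (l <= n)%N -> qpoch Q Q l != 0) ->
  (forall r, (r < n)%N -> al - be * Q^-1 ^+ r != 0) ->
  qpoch (s *: 'X) Q%:P n =
  \sum_(l < n.+1) saalschutz al be Q s l (n - l) *: pair_basis al be Q Q^-1 l (n - l).
Proof.
move=> Q0 Qn0 gap; rewrite qpoch_scaleX.
rewrite (@pascal_expand _ al be Q Q^-1 (fun=> 1) (fun i => s * Q ^+ i)) => [|l p lp].
  apply: eq_bigr => l _; rewrite (pascal_saalschutz s Q0 Qn0 gap) //.
  by have := ltn_ord l; lia.
have -> : node_gap al be Q Q^-1 l p = (al - be * Q^-1 ^+ (l + p)) * Q ^+ l.
  have x0 : Q ^+ l != 0 by rewrite expf_neq0.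
  have y0 : Q ^+ p != 0 by rewrite expf_neq0.
  by rewrite /node_gap !exprVn exprD; field; nonzero.
by rewrite mulf_neq0 ?expf_neq0 ?gap.
Qed.

Variables (al be w1 w2 Q : F) (m k : nat).

(** The index [i] is the length of the factor [(al z; Q)_i] produced by the first expansion. Its
    auxiliary node [w2 Q^(k-m)] is the one at which [(w2 z; 1/Q)_(m-k)] would continue, so the
    remaining [k - i] factors prolong that product. The second expansion starts at [al Q^i] and
    completes [(al z; Q)_i] to [(al z; Q)_l]. *)
Definition connection_coef l := \sum_(i < k.+1 | (i <= l)%N)
  saalschutz al (w2 * Q ^ (k%:Z - m%:Z)) Q (w1 * Q ^ (1 - k%:Z)) i (k - i)
  * vandermonde (al * Q ^+ i) be Q (w2 * Q ^ (1 - m%:Z) * Q ^+ i) (l - i) (m - l).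

Lemma connection_expand : Q != 0 -> (k <= m)%N ->
  (forall l, (l <= m)%N -> qpoch Q Q l != 0) ->
  (forall l p, (l + p < m)%N -> node_gap al be Q Q l p != 0) ->
  (forall r, (r < k)%N -> al - w2 * Q ^ (k%:Z - m%:Z) * Q^-1 ^+ r != 0) ->
  qpoch (w1 *: 'X) Q^-1%:P k * qpoch (w2 *: 'X) Q^-1%:P (m - k) =
  \sum_(l < m.+1) connection_coef l *: pair_basis al be Q Q l (m - l).
Proof.
move=> Q0 lekm Qn0 gap gap2.
rewrite qpoch_scaleX_rev // (saalschutz_expand _ Q0 _ gap2); last first.
  by move=> l lel; apply: Qn0; lia.
rewrite mulr_suml /connection_coef.
under [RHS]eq_bigr => l _ do rewrite scaler_suml big_mkcond.
rewrite exchange_big; apply: eq_bigr => i _ /=; have lti := ltn_ord i.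
rewrite -big_mkcond -scalerAl /pair_basis -[_ * _ * qpoch (w2 *: 'X) _ _]mulrA.
(* The two runs of nodes are adjacent and merge into one of length [m - i]; reversal brings it to
   base [Q]. *)
have -> : qpoch ((w2 * Q ^ (k%:Z - m%:Z)) *: 'X) Q^-1%:P (k - i)
    * qpoch (w2 *: 'X) Q^-1%:P (m - k)
    = qpoch ((w2 * Q ^ (1 - m%:Z) * Q ^+ i) *: 'X) Q%:P (m - i).
  have -> : w2 * Q ^ (k%:Z - m%:Z) = w2 * Q^-1 ^+ (m - k).
    by rewrite exprVn exprnN; congr (_ * _ ^ _); lia.
  rewrite mulrC -qpoch_scaleXD qpoch_scaleX_rev //.
  have -> : (m - k + (k - i) = m - i)%N by lia.
  rewrite [Q ^+ i]exprnP -mulrA -expfzDr //.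
  by congr (qpoch ((_ * _ ^ _) *: _) _ _); lia.
rewrite (@vandermonde_expand (al * Q ^+ i) be (w2 * Q ^ (1 - m%:Z) * Q ^+ i) Q (m - i))
  // => [|l lel|l p lp]; first last.
- have := gap (i + l)%N p; rewrite /node_gap exprD mulrA; apply; lia.
- by apply: Qn0; lia.
(* The sum over [l >= i] is reindexed by [l - i], the index of the second expansion. *)
rewrite -(big_geq_mkord i m.+1 predT (fun l : nat =>
  (saalschutz al (w2 * Q ^ (k%:Z - m%:Z)) Q (w1 * Q ^ (1 - k%:Z)) i (k - i)
   * vandermonde (al * Q ^+ i) be Q (w2 * Q ^ (1 - m%:Z) * Q ^+ i) (l - i) (m - l))
  *: (qpoch (al *: 'X) Q%:P l * qpoch (be *: 'X) Q%:P (m - l)))).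
rewrite (big_addn 0 m.+1 i predT) big_mkord subSn; last by lia.
rewrite mulr_sumr scaler_sumr; apply: eq_bigr => l _; have ltl := ltn_ord l.
have -> : (m - (l + i) = m - i - l)%N by lia.
rewrite addnK [(l + i)%N]addnC qpoch_scaleXD /pair_basis.
rewrite -scalerAr scalerA; congr (_ *: _).
exact: mulrA.
Qed.

End Connection.

Section ClosedConnection.
Variable F : fieldType.
Variables (al be w1 w2 Q : F) (m k l : nat).

(** A terminating 4phi3 in base [Q] at argument [Q], expressed through the nodes. It is balanced:
    the product of the lower parameters is [Q] times that of the upper ones. *)
Definition askey_wilson_sum := \sum_(i < k.+1)
  (qpoch (Q ^- k) Q i * qpoch (w2 / w1 * Q ^ (k%:Z - m%:Z)) Q i
   * qpoch (Q ^- l) Q i * qpoch (Q ^- (m - l) * (al / be)) Q i)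
  / (qpoch Q Q i * qpoch (Q ^- m) Q i * qpoch (al / w1) Q i
     * qpoch (w2 * Q ^ (1 - m%:Z) / be) Q i) * Q ^+ i.

(** The two ratio lemmas express the summand of index [i] through the one of index 0, which is the
    prefactor; the product of the two ratios is the term of the 4phi3. *)
Lemma connection_coefE :
  Q != 0 -> al != 0 -> be != 0 -> w1 != 0 -> (k <= m)%N -> (l <= m)%N ->
  (forall l, (l <= m)%N -> qpoch Q Q l != 0) ->
  (forall l p, (l + p < m)%N -> node_gap al be Q Q l p != 0) ->
  qpoch (al / w1) Q k != 0 -> qpoch (w2 * Q ^ (1 - m%:Z) / be) Q k != 0 ->
  connection_coef al be w1 w2 Q m k l =
  qpoch (w1 * Q ^ (1 - k%:Z) / al) Q k / qpoch (w2 / al * Q ^ (1 - m%:Z)) Q k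
  * (Q ^- (l * (m - l)) * qbin Q l (m - l)
     * (qpoch (w2 * Q ^ (1 - m%:Z) / be) Q l * qpoch (w2 * Q ^ (1 - m%:Z) / al) Q (m - l))
     / (qpoch (Q ^- (m - l) * (al / be)) Q l * qpoch (Q ^- l * (be / al)) Q (m - l)))
  * askey_wilson_sum.
Proof.
move=> Q0 al0 be0 w0 lekm lelm Qn0 gap nz1 nz2.
have qpoch_le x i n : (i <= n)%N -> qpoch x Q n != 0 -> qpoch x Q i != 0.
  by move=> lein; rewrite -(subnKC lein) qpochD mulf_eq0 negb_or => /andP[].
have Qz n : Q ^ n != 0 by rewrite expfz_neq0.
have -> : w2 / al * Q ^ (1 - m%:Z) = w2 * Q ^ (k%:Z - m%:Z) / al * Q ^ (1 - k%:Z).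
  have -> : Q ^ (1 - m%:Z) = Q ^ (k%:Z - m%:Z) * Q ^ (1 - k%:Z).
    by rewrite -expfzDr //; congr (_ ^ _); lia.
  by ring.
rewrite -saalschutz0 ?Qn0 // -vandermondeE // /connection_coef /askey_wilson_sum.
rewrite mulr_sumr big_mkcond; apply: eq_bigr => i _; have lti := ltn_ord i.
(* For [i > l] the left side has no summand, and on the right [(Q^(-l); Q)_i] contains a zero
   factor. *)
case: (leqP i l) => [leil | ltli]; last first.
  have -> : qpoch (Q ^- l) Q i = 0.
    rewrite -(subnKC ltli) qpochD qpochS.
    by rewrite mulVf ?expf_neq0 // subrr mulr0 mul0r.
  by rewrite !(mulr0, mul0r).
have s0 : w1 * Q ^ (1 - k%:Z) != 0 by rewrite mulf_neq0.
have eqs : al / (w1 * Q ^ (1 - k%:Z)) * Q ^ (1 - k%:Z) = al / w1.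
  by have := Qz (1 - k%:Z); move: (_ ^ _) => x x0; field; nonzero.
rewrite saalschutz_ratio ?subnKC //; first last.
- by rewrite eqs; apply: qpoch_le nz1; lia.
- by move=> j lej; apply: Qn0; lia.
rewrite vandermonde_ratio // ?subnK //; first last.
- by apply: qpoch_le nz2; lia.
- apply: hpoch_neq0 => r ltr; have := gap l r ltac:(lia).
  by rewrite /node_gap [al * _]mulrC.
- move=> r ltr; have := gap r (m - l)%N ltac:(lia).
  by rewrite /node_gap subr_neq0C [be * _]mulrC.
- by rewrite subnKC.
rewrite subnKC // eqs.
have -> : w2 * Q ^ (k%:Z - m%:Z) / (w1 * Q ^ (1 - k%:Z)) * Q ^ (1 - k%:Z)
    = w2 / w1 * Q ^ (k%:Z - m%:Z).
  have := Qz (1 - k%:Z); move: (Q ^ (1 - k%:Z)) (Q ^ (k%:Z - m%:Z)) => x y x0.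
  by field; nonzero.
by rewrite !invfM; ring.
Qed.

End ClosedConnection.

(** * Bases of polynomials of bounded degree *)

Section PolyBasis.
Variable F : fieldType.
Implicit Types (e : nat -> {poly F}) (f : {poly F}).

(** Only spanning is recorded: [m + 1] spanning elements of a space of dimension [m + 1] are
    independent. *)
Definition poly_basis m e :=
  (forall l, (l <= m)%N -> (size (e l) <= m.+1)%N) /\
  (forall f, (size f <= m.+1)%N ->
     exists c : 'I_m.+1 -> F, f = \sum_(l < m.+1) c l *: e l).

(** Expanding the monomials gives a left inverse [N] of the square coefficient matrix [M]. It is
    also a right inverse, so a row killed by [M] is zero. *)
Lemma poly_basis_free m e (c : 'I_m.+1 -> F) : poly_basis m e ->
  \sum_(l < m.+1) c l *: e l = 0 -> forall l, c l = 0.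
Proof.
move=> [size_e span_e] ce0.
have /fin_all_exists[N NE] (j : 'I_m.+1) : exists d : 'I_m.+1 -> F,
    'X^j = \sum_(l < m.+1) d l *: e l.
  by apply: span_e; rewrite size_polyXn.
pose M := \matrix_(l < m.+1, j < m.+1) (e l)`_j.
have NM : (\matrix_(j, l) N j l) *m M = 1%:M.
  apply/matrixP => i j; rewrite !mxE.
  have := congr1 (fun f : {poly F} => f`_j) (NE i).
  rewrite coefXn coef_sum eq_sym => ->.
  by apply: eq_bigr => l _; rewrite !mxE coefZ.
have cM : (\row_l c l) *m M = 0.
  apply/rowP => j; rewrite !mxE -[RHS](coef0 _ j) -ce0 coef_sum.
  by apply: eq_bigr => l _; rewrite !mxE coefZ.
move=> l; have : (\row_l c l) = 0.
  by rewrite -[LHS]mulmx1 -(mulmx1C NM) mulmxA cM mul0mx.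
by move/rowP/(_ l); rewrite !mxE.
Qed.

Lemma poly_basis_inj m e (c d : 'I_m.+1 -> F) : poly_basis m e ->
  \sum_(l < m.+1) c l *: e l = \sum_(l < m.+1) d l *: e l -> c =1 d.
Proof.
move=> be cd l; apply/eqP; rewrite -subr_eq0; apply/eqP; move: l.
apply: (poly_basis_free be); under eq_bigr do rewrite scalerBl.
by rewrite sumrB cd subrr.
Qed.

Lemma size_qpoch (x y : F) n : (size (qpoch (x *: 'X) y%:P n) <= n.+1)%N.
Proof.
elim: n => [|n IHn]; first by rewrite qpoch0 size_poly1.
rewrite qpochS; apply: (leq_trans (size_polyMleq _ _)).
suff s2 : (size (1 - x *: 'X * y%:P ^+ n)%R <= 2)%N.
  have := leq_add IHn s2; rewrite addn2; case: (_ + _)%N => //.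
rewrite (leq_trans (size_polyD _ _)) // geq_max size_poly1 size_polyN /=.
  rewrite -polyC_exp mulrC mul_polyC scalerA.
  by rewrite (leq_trans (size_scale_leq _ _)) // size_polyX.
Qed.

(** A monomial of degree at most [m] is itself a product of [m] factors of the kind treated by
    [pascal_expand], which therefore yields spanning. *)
Lemma pair_basis_poly_basis (al be Q Q' : F) m :
  (forall l p, (l + p < m)%N -> node_gap al be Q Q' l p != 0) ->
  poly_basis m (fun l => pair_basis al be Q Q' l (m - l)).
Proof.
move=> gap; split=> [l lelm | f sf].
  apply: (leq_trans (size_polyMleq _ _)).
  have := leq_add (size_qpoch al Q l) (size_qpoch be Q' (m - l)).
  by case: (_ + _)%N => // n; rewrite addSn addnS subnKC.
have X_span (j : 'I_m.+1) : exists c : 'I_m.+1 -> F,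
    'X^j = \sum_(l < m.+1) c l *: pair_basis al be Q Q' l (m - l).
  have ltj := ltn_ord j.
  (* The first [j] factors are [0 + X], the others are [1 - 0 X]; their product is [X^j]. *)
  pose x0 i : F := if (i < j)%N then 0 else 1.
  pose x1 i : F := if (i < j)%N then -1 else 0.
  exists (fun l => pascal al be Q Q' x0 x1 l (m - l)); rewrite -pascal_expand //.
  rewrite /x0 /x1 -(big_mkord predT (fun i => (if (i < j)%N then 0 else 1)%:P
    - (if (i < j)%N then -1 else 0) *: 'X)) (big_cat_nat _ (n := j)) //=.
  rewrite [X in X * _](eq_big_nat _ _ (F2 := fun=> 'X)) => [|i /andP[_ ->]]; last first.
    by rewrite sub0r scaleN1r opprK.
  rewrite [X in _ * X](eq_big_nat _ _ (F2 := fun=> 1)) => [|i /andP[lei _]]; last first.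
    by rewrite ltnNge lei scale0r subr0.
  by rewrite big1_eq mulr1 prodr_const_nat subn0.
have /fin_all_exists[c cE] := X_span.
exists (fun l => \sum_(j < m.+1) f`_j * c j l).
have fE : f = \sum_(j < m.+1) f`_j *: 'X^j.
  by rewrite -poly_def; apply/polyP => i; rewrite coef_poly; case: ltnP => // mi;
     rewrite nth_default // (leq_trans sf).
rewrite {1}fE; under [RHS]eq_bigr do rewrite scaler_suml.
rewrite exchange_big; apply: eq_bigr => j _ /=; rewrite cE scaler_sumr.
by apply: eq_bigr => l _; rewrite scalerA.
Qed.

End PolyBasis.

(** * Matching the parameters of R *)

Section RcoefFormula.
Variables (K : numFieldType) (q s : K) (m : nat) (a u : K).
Hypotheses (q0 : q != 0) (q_nru : not_root_of_unity q) (s_sqrt : s ^+ 2 = q).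
Hypotheses (a0 : a != 0) (u0 : u != 0).

Lemma qpoch_qq_neq0 n : qpoch (q ^+ 2) (q ^+ 2) n != 0.
Proof.
apply/prodf_neq0 => i _; rewrite -exprS -exprM subr_eq0 eq_sym.
by apply: q_nru; rewrite muln_gt0.
Qed.

Let c := u * s ^- m.
Let d := s ^+ m * u^-1.

Lemma upper_parameterE b : b != 0 ->
  q ^ (2 - m%:Z) * a^-1 * b * u ^- 2
  = (d / b^-1) * (q ^+ 2) ^ (1 - m%:Z) / (c * a).
Proof.
move=> b0.
have s0 : s != 0 by move: q0; rewrite -s_sqrt expf_eq0.
have y0 : s ^+ m != 0 by rewrite expf_neq0.
have -> : q ^ (2 - m%:Z) = (q ^+ 2) ^ (1 - m%:Z) * (s ^+ m * s ^+ m).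
  have -> : s ^+ m * s ^+ m = q ^ m%:Z by rewrite -exprnP -s_sqrt -exprM mulnC exprM expr2.
  by rewrite [q ^+ 2]exprnP exprz_exp -expfzDr //; congr (_ ^ _); lia.
by rewrite /c /d; field; nonzero.
Qed.

(** The dictionary is [Q = q^2], [al = c a], [be = c/a], [w1 = d/b], [w2 = d b], where
    [c = u q^(-j)] and [d = q^j / u]. It turns the 4phi3 of R into [askey_wilson_sum] parameter by
    parameter. *)
Lemma Rcoef_formulaE k l b : b != 0 -> (k <= m)%N -> (l <= m)%N ->
  (forall l p, (l + p < m)%N ->
     node_gap (c * a) (c / a) (q ^+ 2) (q ^+ 2) l p != 0) ->
  Rcoef_defined q m k l a b u ->
  Rcoef_formula q m k l a b u =
  connection_coef (c * a) (c / a) (d * b^-1) (d / b^-1) (q ^+ 2) m k l.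
Proof.
move=> b0 lekm lelm gap.
rewrite /Rcoef_defined /Rcoef_formula /phi43 /qbinom.
have QE (n : int) : (q ^+ 2) ^ n = q ^ (2 * n) by rewrite exprnP exprz_exp.
have QEN n : (q ^+ 2) ^- n = q ^ (- 2 * n%:Z) by rewrite exprnN QE; congr (_ ^ _); lia.
have s0 : s != 0 by move: q0; rewrite -s_sqrt expf_eq0.
have y0 : s ^+ m != 0 by rewrite expf_neq0.
have qm : q ^ m%:Z = s ^+ m * s ^+ m.
  by rewrite -exprnP -s_sqrt -exprM mulnC exprM expr2.
have qz n : q ^ n != 0 by rewrite expfz_neq0.
have c0 : c != 0 by rewrite mulf_neq0 ?invr_eq0.
have d0 : d != 0 by rewrite mulf_neq0 ?invr_eq0.
(* In the uses below, removing [q^m = s^m s^m] leaves an even power of [q], hence a power of [Q],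
   while the powers of [s] are absorbed by [c] and [d]. *)
have split n : q ^ n = q ^ (n - m%:Z) * (s ^+ m * s ^+ m).
  by rewrite -qm -expfzDr //; congr (_ ^ _); lia.
have E1 : q ^ (2 - m%:Z) * a * b * u ^- 2 = (d / b^-1) * (q ^+ 2) ^ (1 - m%:Z) / (c / a).
  rewrite QE (split (2 - m%:Z)) /c /d.
  have -> : 2 - m%:Z - m%:Z = 2 * (1 - m%:Z) by lia.
  by field; nonzero.
have E2 := upper_parameterE b0.
have E2' : (d / b^-1) / (c * a) * (q ^+ 2) ^ (1 - m%:Z)
           = (d / b^-1) * (q ^+ 2) ^ (1 - m%:Z) / (c * a).
  by rewrite mulrAC.
have E3 : q ^ (2 + m%:Z - 2 * k%:Z) * a^-1 * b^-1 * u ^- 2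
          = (d * b^-1) * (q ^+ 2) ^ (1 - k%:Z) / (c * a).
  rewrite QE (split (2 + m%:Z - 2 * k%:Z)) /c /d.
  have -> : 2 + m%:Z - 2 * k%:Z - m%:Z = 2 * (1 - k%:Z) by lia.
  by field; nonzero.
have E4 : q ^ (2 * l%:Z - 2 * m%:Z) * a ^+ 2 = (q ^+ 2) ^- (m - l) * ((c * a) / (c / a)).
  rewrite QEN; have -> : - 2 * (m - l)%N%:Z = 2 * l%:Z - 2 * m%:Z by lia.
  by field; nonzero.
have E5 : q ^ (- 2 * l%:Z) * a ^- 2 = (q ^+ 2) ^- l * ((c / a) / (c * a)).
  by rewrite QEN; field; nonzero.
have E6 : q ^ (2 * k%:Z - 2 * m%:Z) * b ^+ 2 = (d / b^-1) / (d * b^-1) * (q ^+ 2) ^ (k%:Z - m%:Z).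
  rewrite QE; have -> : 2 * (k%:Z - m%:Z) = 2 * k%:Z - 2 * m%:Z by lia.
  by field; nonzero.
have E8 : q ^ (- m%:Z) * a * b * u ^+ 2 = (c * a) / (d * b^-1).
  by rewrite -invr_expz qm /c /d; field; nonzero.
have E9 : q ^ (2 * l%:Z * (l%:Z - m%:Z)) = (q ^+ 2) ^- (l * (m - l)).
  by rewrite QEN; congr (_ ^ _); nia.
rewrite E1 E2 E3 E4 E5 E6 E8 E9 -!QEN => /and5P[_ _ _ _ /and4P[_ _ nz1 nz2]].
rewrite connection_coefE ?mulf_neq0 ?invr_eq0 ?expf_neq0 //; last first.
  by move=> n _; exact: qpoch_qq_neq0.
rewrite E2' /askey_wilson_sum /qbin subnKC //.
congr (_ * _); rewrite !invfM; ring.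
Qed.

End RcoefFormula.

(** * Continuity in b *)

Section Limits.
Variable K : numFieldType.

(** The nodes [x1] occur only in the numerators of [wl] and [wr]; the divisors [node_gap] do not
    move with [t]. The coefficients are thus polynomial in the nodes. *)
Lemma pascal_cvg (al be Q Q' : K) (x1 : K -> nat -> K) (b : K) :
  (forall i, x1 t i @[t --> b] --> x1 b i) ->
  forall l p, pascal al be Q Q' (fun=> 1) (x1 t) l p @[t --> b]
              --> pascal al be Q Q' (fun=> 1) (x1 b) l p.
Proof.
move=> x1_cvg.
have wl_cvg l p : wl al be Q Q' (fun=> 1) (x1 t) l p @[t --> b]
                  --> wl al be Q Q' (fun=> 1) (x1 b) l p.
  exact: (cvgM (cvgB (x1_cvg _) (cvg_cst _)) (cvg_cst _)).
have wr_cvg l p : wr al be Q Q' (fun=> 1) (x1 t) l p @[t --> b]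
                  --> wr al be Q Q' (fun=> 1) (x1 b) l p.
  exact: (cvgM (cvgB (cvg_cst _) (x1_cvg _)) (cvg_cst _)).
elim=> [|l IHl]; elim=> [|p IHp].
- exact: (@cvg_cst K 1 K (nbhs b) _).
- exact: (cvgM (wr_cvg 0 p) IHp).
- exact: (cvgM (wl_cvg l 0) (IHl 0)).
- exact: (cvgD (cvgM (wl_cvg l p.+1) (IHl p.+1)) (cvgM (wr_cvg l.+1 p) IHp)).
Qed.

Lemma near_dnbhs_neq (b y : K) : \forall t \near b^', t != y.
Proof.
have [->|yb] := eqVneq y b; first exact: nbhs_dnbhs_neq.
apply: nbhs_dnbhs; apply: open_nbhs_nbhs; split; last by rewrite /= eq_sym.
have := @accessible_closed_set1 K (hausdorff_accessible (@norm_hausdorff _ _)) y.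
rewrite -openC; congr open; apply/seteqP; split=> t /=.
  by move=> ty; apply/eqP.
by move=> /eqP.
Qed.

Lemma near_qpoch_neq0 (b e Q : K) n : \forall t \near b^', qpoch (e * t) Q n != 0.
Proof.
elim: n => [|n IHn]; first by near=> t; rewrite qpoch0 oner_neq0.
near=> t; rewrite qpochS mulf_neq0 //; first by near: t.
(* The new factor can vanish only at this point. If [e * Q ^+ n] is 0, its inverse is 0 by
   convention and the factor is 1. *)
have : t != (e * Q ^+ n)^-1 by near: t; exact: near_dnbhs_neq.
apply: contraNneq => /eqP; rewrite subr_eq0 eq_sym => /eqP e1.
have e0 : e * Q ^+ n != 0.
  apply: contra_eq_neq e1 => e0; rewrite mulrAC e0 mul0r eq_sym; exact: oner_neq0.
by apply/eqP; apply: (mulfI e0); rewrite divff // -e1; ring.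
Unshelve. all: by end_near. Qed.

End Limits.

(** * R as the expansion coefficients in one variable *)

Section RcoefExpansion.
Variables (K : numFieldType) (q s : K) (m : nat) (a u : K).
Hypotheses (q0 : q != 0) (q_nru : not_root_of_unity q) (s_sqrt : s ^+ 2 = q).
Hypotheses (a0 : a != 0) (u0 : u != 0).

Let c := u * s ^- m.
Let d := s ^+ m * u^-1.
Let Q := q ^+ 2.

Hypothesis gap : forall l p, (l + p < m)%N -> node_gap (c * a) (c / a) Q Q l p != 0.

(** The nodes [x] of the [m] factors [1 - x z] of [pbasis k d b^-1 m q^-1]. Since all constant terms
    are 1, [b] enters the recursion only here. *)
Definition wnode k b i :=
  if (i < k)%N then d * b^-1 * Q^-1 ^+ i else d / b^-1 * Q^-1 ^+ (i - k).

Lemma pbasis_pascal k b : (k <= m)%N ->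
  pbasis k d b^-1 m q^-1 =
  \sum_(l < m.+1) pascal (c * a) (c / a) Q Q (fun=> 1) (wnode k b) l (m - l)
                  *: pbasis l c a m q.
Proof.
move=> lekm; rewrite -[RHS](pascal_expand (fun=> 1) (wnode k b) gap).
rewrite /pbasis exprVn -/Q !qpoch_scaleX -[in RHS](subnKC lekm) big_split_ord /=.
congr (_ * _); apply: eq_bigr => i _; rewrite /wnode.
  by rewrite ltn_ord.
by rewrite ltnNge leq_addr /= addKn.
Qed.

(** Both sides are coefficients of the same polynomial on the same basis. *)
Lemma Rcoef_formula_pascal k l b : b != 0 -> (k <= m)%N -> (l <= m)%N ->
  Rcoef_defined q m k l a b u ->
  Rcoef_formula q m k l a b u =
  pascal (c * a) (c / a) Q Q (fun=> 1) (wnode k b) l (m - l).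
Proof.
move=> b0 lekm lelm Rdef; rewrite (Rcoef_formulaE q0 q_nru s_sqrt a0 u0) //.
have Q0 : Q != 0 by rewrite expf_neq0.
have s0 : s != 0 by move: q0; rewrite -s_sqrt expf_eq0.
have c0 : c != 0 by rewrite mulf_neq0 ?invr_eq0 ?expf_neq0.
have eqb : \sum_(i < m.+1) connection_coef (c * a) (c / a) (d * b^-1) (d / b^-1) Q m k i
              *: pair_basis (c * a) (c / a) Q Q i (m - i) =
           \sum_(i < m.+1) pascal (c * a) (c / a) Q Q (fun=> 1) (wnode k b) i (m - i)
              *: pair_basis (c * a) (c / a) Q Q i (m - i).
  rewrite -connection_expand //; first last.
  (* The gap of index [r] vanishes only together with the factor of index [k - 1 - r] in
     [(q^(2-2j) b/(a u^2); q^2)_k], one of the products that [Rcoef_defined] keeps nonzero. *)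
  - move=> r ltr; have ltk : (k.-1 - r < k)%N by lia.
    move: Rdef => /and5P[_ _ _ /prodf_neq0 /(_ (Ordinal ltk) isT) /= nz _].
    apply: contra nz.
    rewrite !subr_eq0 => /eqP e.
    rewrite (upper_parameterE _ q0 s_sqrt a0 u0 b0) -/c -/d -/Q.
    have e' : c * a = d / b^-1 * Q ^ (k%:Z - m%:Z) * Q^-1 ^+ r by exact: e.
    have -> : d / b^-1 * Q ^ (1 - m%:Z)
        = d / b^-1 * Q ^ (k%:Z - m%:Z) * Q^-1 ^+ r * Q ^ (r%:Z + 1 - k%:Z).
      rewrite exprVn exprnN -!mulrA -!expfzDr //.
      congr (_ * (_ * (_ * Q ^ _))); lia.
    rewrite -e'; have -> : Q ^+ (k.-1 - r) = (Q ^ (r%:Z + 1 - k%:Z))^-1.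
      by rewrite invr_expz exprnP; congr (_ ^ _); lia.
    have := expfz_neq0 (r%:Z + 1 - k%:Z) Q0; move: (Q ^ _) => x x0.
    by apply/eqP; field; nonzero.
  - by move=> i _; exact: qpoch_qq_neq0.
  by rewrite -exprVn; apply: pbasis_pascal.
have lt_lm : (l < m.+1)%N by [].
have := poly_basis_inj (pair_basis_poly_basis gap) eqb.
by move/(_ (Ordinal lt_lm)).
Qed.

(** The three products containing [b] have the form [(e t; q^2)_k] and vanish for finitely many [t].
    The two products in [a] alone consist of gaps, and the remaining ones are nonzero because [q] is
    not a root of unity. *)
Lemma Rcoef_defined_near k l b : (k <= m)%N -> (l <= m)%N -> 
  \forall t \near b^', Rcoef_defined q m k l a t u.
Proof.
have Q0 : Q != 0 by rewrite expf_neq0.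
move=> lekm lelm; near=> t; rewrite /Rcoef_defined.
have Qnz n : qpoch (q ^+ 2) (q ^+ 2) n != 0 by exact: qpoch_qq_neq0.
apply/and5P; split; last apply/and4P; last split.
- by rewrite mulf_neq0.
- apply/prodf_neq0 => i _; have lti := ltn_ord i.
  have := gap (l := i) (p := (m - l)%N) ltac:(lia).
  apply: contraNneq; rewrite /node_gap => e.
  have -> : c / a = c / a * (q ^ (2 * l%:Z - 2 * m%:Z) * a ^+ 2 * (q ^+ 2) ^+ i).
    by move/eqP: e; rewrite subr_eq0 => /eqP <-; rewrite mulr1.
  have -> : q ^ (2 * l%:Z - 2 * m%:Z) = (Q ^+ (m - l))^-1.
    rewrite exprnN [Q]exprnP exprz_exp; congr (_ ^ _); lia.
  have := expf_neq0 (m - l) Q0; rewrite -/Q; move: (Q ^+ (m - l)) => x x0.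
  by apply/eqP; field; nonzero.
- apply/prodf_neq0 => i _; have lti := ltn_ord i.
  have := gap (l := l) (p := i) ltac:(lia).
  apply: contraNneq; rewrite /node_gap => e.
  have -> : c * a = c * a * (q ^ (- 2 * l%:Z) * a ^- 2 * (q ^+ 2) ^+ i).
    by move/eqP: e; rewrite subr_eq0 => /eqP <-; rewrite mulr1.
  have -> : q ^ (- 2 * l%:Z) = (Q ^+ l)^-1.
    rewrite exprnN [Q]exprnP exprz_exp; congr (_ ^ _); lia.
  have := expf_neq0 l Q0; rewrite -/Q; move: (Q ^+ l) => x x0.
  by apply/eqP; field; nonzero.
- suff -> : q ^ (2 - m%:Z) * a^-1 * t * u ^- 2 = q ^ (2 - m%:Z) * a^-1 * u ^- 2 * t.
    by near: t; exact: near_qpoch_neq0.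
  by ring.
- by [].
(* Here [i < k <= m], so the exponent [-2(m - i)] is not zero. *)
- apply/prodf_neq0 => i _; have lti := ltn_ord i.
  rewrite [(q ^+ 2) ^+ i]exprnP [q ^+ 2]exprnP exprz_exp -expfzDr //.
  have -> : - 2 * m%:Z + 2 * i%:Z = - (2 * (m - i))%N%:Z by lia.
  rewrite -invr_expz subr_eq0 eq_sym invr_eq1; apply: q_nru; lia.
- suff -> : q ^ (- m%:Z) * a * t * u ^+ 2 = q ^ (- m%:Z) * a * u ^+ 2 * t.
    by near: t; exact: near_qpoch_neq0.
  by ring.
- suff -> : q ^ (2 - m%:Z) * a * t * u ^- 2 = q ^ (2 - m%:Z) * a * u ^- 2 * t.
    by near: t; exact: near_qpoch_neq0.
  by ring.
Unshelve. all: by end_near. Qed.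

(** At a singular [b], the formula agrees on a punctured neighbourhood with the recursion
    coefficients. These are continuous at [b], so the limit is their value there. *)
Lemma Rcoef_pascal k l b : b != 0 -> (k <= m)%N -> (l <= m)%N ->
  Rcoef q m k l a b u =
  pascal (c * a) (c / a) Q Q (fun=> 1) (wnode k b) l (m - l).
Proof.
move=> b0 lekm lelm; rewrite /Rcoef; case: ifP => [|_]; first exact: Rcoef_formula_pascal.
apply: cvg_lim; first exact: norm_hausdorff.
apply: (@cvg_trans _ (pascal (c * a) (c / a) Q Q (fun=> 1) (wnode k t) l (m - l) @[t --> b^'])).
  apply: near_eq_cvg; near=> t; rewrite Rcoef_formula_pascal //.
    by near: t; exact: near_dnbhs_neq.
  by near: t; exact: Rcoef_defined_near.
apply: (@cvg_trans _ (pascal (c * a) (c / a) Q Q (fun=> 1) (wnode k t) l (m - l) @[t --> b])).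
  exact: (cvg_app _ (@nbhs_dnbhs K b)).
have id_cvg : t @[t --> b] --> b by exact: cvg_id.
have inv_cvg : t^-1 @[t --> b] --> b^-1 by exact: (cvgV b0 id_cvg).
have invK_cvg : t^-1^-1 @[t --> b] --> b^-1^-1.
  by apply: (cvgV _ inv_cvg); rewrite invr_eq0.
apply: pascal_cvg => i; rewrite /wnode; case: ifP => _.
  exact: (cvgM (cvgM (cvg_cst _) inv_cvg) (cvg_cst _)).
exact: (cvgM (cvgM (cvg_cst _) invK_cvg) (cvg_cst _)).
Unshelve. all: by end_near. Qed.

Lemma Rcoef_expand k b : b != 0 -> (k <= m)%N ->
  pbasis k d b^-1 m q^-1 =
  \sum_(l < m.+1) Rcoef q m k l a b u *: pbasis l c a m q.
Proof.
move=> b0 lekm; rewrite pbasis_pascal //.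
by apply: eq_bigr => l _; rewrite Rcoef_pascal // -ltnS.
Qed.

End RcoefExpansion.

(** * Two variables *)

Section Tensors.
Variable K : numFieldType.
Implicit Types (g h : {poly K}) (F : {poly {poly K}}).

Lemma coef_tens g h i : (tens g h)`_i = g`_i *: h.
Proof. by rewrite /tens coefMC coef_map /= mul_polyC. Qed.

Lemma swapXY_tens g h : swapXY (tens g h) = tens h g.
Proof. by rewrite /tens rmorphM /= swapXY_map_polyC swapXY_polyC mulrC. Qed.

Lemma tens_sumZl n (c : 'I_n -> K) (g : 'I_n -> {poly K}) h :
  tens (\sum_i c i *: g i) h = \sum_i (c i)%:P *: tens (g i) h.
Proof.
apply/polyP => j; rewrite coef_tens !coef_sum scaler_suml.
by apply: eq_bigr => i _; rewrite !coefZ coef_tens mul_polyC scalerA.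
Qed.

Lemma tens_sumZr n (c : 'I_n -> K) g (h : 'I_n -> {poly K}) :
  tens g (\sum_i c i *: h i) = \sum_i (c i)%:P *: tens g (h i).
Proof.
apply/polyP => j; rewrite coef_tens !coef_sum scaler_sumr.
by apply: eq_bigr => i _; rewrite !coefZ coef_tens mul_polyC !scalerA mulrC.
Qed.

Lemma tensDl g1 g2 h : tens (g1 + g2) h = tens g1 h + tens g2 h.
Proof. by rewrite /tens rmorphD mulrDl. Qed.

Lemma tensDr g h1 h2 : tens g (h1 + h2) = tens g h1 + tens g h2.
Proof. by rewrite /tens polyCD mulrDr. Qed.

Lemma tensZl c g h : tens (c *: g) h = c%:P *: tens g h.
Proof. by apply/polyP => i; rewrite !coefZ !coef_tens coefZ mul_polyC scalerA. Qed.

Lemma tensZr c g h : tens g (c *: h) = c%:P *: tens g h.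
Proof.
by apply/polyP => i; rewrite !coefZ !coef_tens mul_polyC !scalerA mulrC.
Qed.

(** This description is symmetric in the two variables, which makes the swap immediate. *)
Lemma in_spaceP m1 m2 F : in_space m1 m2 F <->
  (forall i j, (m1 < i)%N || (m2 < j)%N -> F`_i`_j = 0).
Proof.
split=> [[sF sFi] i j /orP[lti | ltj] | F0].
- have -> : F`_i = 0 by rewrite nth_default // (leq_trans sF).
  exact: coef0.
- by rewrite nth_default // (leq_trans (sFi i)).
split=> [|i]; apply/leq_sizeP => j ltj; last by apply: F0; rewrite ltj orbT.
by apply/polyP => k; rewrite coef0; apply: F0; rewrite ltj.
Qed.

Lemma in_space_swap m1 m2 F : in_space m1 m2 F -> in_space m2 m1 (swapXY F).
Proof.
move=> /in_spaceP F0; apply/in_spaceP => i j ij; rewrite coef_swapXY.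
by apply: F0; rewrite orbC.
Qed.

(** Reduces a basis whose second tensor factor depends on the first index to the form required by
    [tens_is_basis]. *)
Lemma is_basis_swap m1 m2 (e : nat -> nat -> {poly {poly K}}) :
  is_basis m2 m1 (fun n2 n1 => swapXY (e n1 n2)) -> is_basis m1 m2 e.
Proof.
move=> [e_in e_span]; split=> [n1 n2 le1 le2 | F F_in].
  by rewrite -[e n1 n2]swapXYK; apply/in_space_swap/e_in.
have swap_sum (c : {ffun 'I_m1.+1 * 'I_m2.+1 -> K}) :
    swapXY (\sum_(i < m1.+1) \sum_(j < m2.+1) (c (i, j))%:P *: e i j) =
    \sum_(j < m2.+1) \sum_(i < m1.+1)
      ([ffun x : 'I_m2.+1 * 'I_m1.+1 => c (x.2, x.1)] (j, i))%:P *: swapXY (e i j).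
  rewrite exchange_big raddf_sum; apply: eq_bigr => j _ /=.
  rewrite raddf_sum; apply: eq_bigr => i _ /=; rewrite ffunE /=.
  by rewrite -!mul_polyC rmorphM /= swapXY_polyC map_polyC.
have [c [cE c_uniq]] := e_span _ (in_space_swap F_in).
exists [ffun x => c (x.2, x.1)]; split=> [|d dE].
  apply: (can_inj swapXYK); rewrite cE swap_sum; apply: eq_bigr => j _.
  by apply: eq_bigr => i _; rewrite !ffunE.
have := c_uniq [ffun x => d (x.2, x.1)]; rewrite dE swap_sum => /(_ erefl) ->.
by apply/ffunP => -[i j]; rewrite !ffunE.
Qed.

(** Expansion goes in two stages: first on [h] in [z2], then, for each [j], the polynomial in [z1]
    multiplying [h j] on the basis [g _ j], which may vary with [j]. Uniqueness uses the same two
    stages. *)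
Lemma tens_is_basis m1 m2 (g : nat -> nat -> {poly K}) (h : nat -> {poly K}) :
  (forall n2, (n2 <= m2)%N -> poly_basis m1 (g^~ n2)) -> poly_basis m2 h ->
  is_basis m1 m2 (fun n1 n2 => tens (g n1 n2) (h n2)).
Proof.
move=> g_basis h_basis.
have coef_comb (c : {ffun 'I_m1.+1 * 'I_m2.+1 -> K}) i :
    (\sum_(l < m1.+1) \sum_(j < m2.+1) (c (l, j))%:P *: tens (g l j) (h j))`_i
    = \sum_(j < m2.+1) (\sum_(l < m1.+1) c (l, j) *: g l j)`_i *: h j.
  rewrite exchange_big coef_sum; apply: eq_bigr => j _ /=.
  rewrite !coef_sum scaler_suml; apply: eq_bigr => l _.
  by rewrite !coefZ coef_tens mul_polyC scalerA.
split=> [n1 n2 le1 le2 | F F_in].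
  apply/in_spaceP => i j ij; rewrite coef_tens coefZ.
  case/orP: ij => [lti | ltj].
    rewrite [X in X * _]nth_default ?mul0r //.
    by apply: leq_trans lti; apply: (g_basis n2 le2).1.
  rewrite [X in _ * X]nth_default ?mulr0 //.
  by apply: leq_trans ltj; apply: h_basis.1.
have /fin_all_exists[d dE] (i : 'I_m1.+1) : exists d : 'I_m2.+1 -> K,
    F`_i = \sum_(j < m2.+1) d j *: h j.
  by apply: h_basis.2; apply: F_in.2.
pose G j := \poly_(i < m1.+1) d (inord i) j.
have /fin_all_exists[c cE] (j : 'I_m2.+1) : exists c : 'I_m1.+1 -> K,
    G j = \sum_(l < m1.+1) c l *: g l j.
  by apply: (g_basis j (ltn_ord j : (j <= m2)%N)).2; exact: size_poly.
pose C := [ffun x : 'I_m1.+1 * 'I_m2.+1 => c x.2 x.1].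
have CE j : \sum_(l < m1.+1) C (l, j) *: g l j = G j.
  by rewrite cE; apply: eq_bigr => l _; rewrite ffunE.
have FE : F = \sum_(l < m1.+1) \sum_(j < m2.+1) (C (l, j))%:P *: tens (g l j) (h j).
  apply/polyP => i; rewrite coef_comb.
  under eq_bigr do rewrite CE coef_poly.
  case: ltnP => [lti | lei].
    by rewrite -(inordK lti) dE inord_val.
  rewrite big1 => [|j _]; last by rewrite scale0r.
  by rewrite nth_default // (leq_trans F_in.1).
exists C; split=> // D DE.
apply/ffunP => -[l j]; move: l.
apply: (poly_basis_inj (g_basis j (ltn_ord j : (j <= m2)%N))).
apply/polyP => i; move: j; apply: (poly_basis_inj h_basis).
by rewrite -!coef_comb -FE -DE.
Qed.

End Tensors.

(** * The operators in one variable and on tensors *)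

Section Operators.
Variable K : numFieldType.
Implicit Types (f g h : {poly K}) (X : {poly K} -> {poly K}).

Lemma on2_tens X g h : (forall c f, X (c *: f) = c *: X f) ->
  on2 X (tens g h) = tens g (X h).
Proof.
move=> XZ; have X0 : X 0 = 0 by rewrite -[0 in LHS](scale0r 0) XZ scale0r.
by apply/polyP => i; rewrite /on2 coef_map_id0 // !coef_tens XZ.
Qed.

Lemma on1_tens X g h : (forall c f, X (c *: f) = c *: X f) ->
  on1 X (tens g h) = tens (X g) h.
Proof.
move=> XZ; rewrite /on1 swapXY_tens.
by rewrite -[map_poly X _]/(on2 X _) on2_tens // swapXY_tens.
Qed.

Lemma divXMX f : divX ('X * f) = f.
Proof.
by apply/polyP => i; rewrite /divX coef_drop_poly mulrC coefMX addn1.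
Qed.

Lemma divXD f g : divX (f + g) = divX f + divX g.
Proof. by apply/polyP => i; rewrite /divX coefD !coef_drop_poly coefD. Qed.

Lemma divXZ c f : divX (c *: f) = c *: divX f.
Proof. by apply/polyP => i; rewrite /divX coefZ !coef_drop_poly coefZ. Qed.

Variables (q s : K).

Let Tp2 f := T_plus q (T_plus q f).

Lemma T_plusZ c f : T_plus q (c *: f) = c *: T_plus q f.
Proof. by rewrite /T_plus comp_polyZ. Qed.

Lemma Tp2Z c f : Tp2 (c *: f) = c *: Tp2 f.
Proof. by rewrite /Tp2 !T_plusZ. Qed.

Lemma T_plusM f g : T_plus q (f * g) = T_plus q f * T_plus q g.
Proof. by rewrite /T_plus comp_polyM. Qed.

Lemma T_plus_qpoch x y n :
  T_plus q (qpoch (x *: 'X) y%:P n) = qpoch ((x * q) *: 'X) y%:P n.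
Proof.
rewrite !qpoch_scaleX /T_plus rmorph_prod; apply: eq_bigr => i _ /=.
by rewrite comp_polyB comp_polyC comp_polyZ comp_polyX scalerA mulrAC.
Qed.

Lemma opAZ m a u c f : opA q s m a u (c *: f) = c *: opA q s m a u f.
Proof.
rewrite /opA -/(Tp2 _) Tp2Z -!scalerAr scalerDr -divXZ !scalerA.
by rewrite scalerBr !scalerA ![_ * c]mulrC.
Qed.

Hypotheses (q0 : q != 0) (s_sqrt : s ^+ 2 = q).

(* Replacing a by a' changes opA by a multiple of T_+^2; this absorbs the
   coproduct term of opA12 and opA21. *)
Lemma opA_shift m a a' u f : a != 0 -> a' != 0 -> u != 0 ->
  opA q s m a u f + (q ^- m * (a' + a'^-1 - (a + a^-1))) *: Tp2 f = opA q s m a' u f.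
Proof.
move=> a0 a'0 u0; rewrite /opA -/(Tp2 _) -addrA; congr (_ + _).
have s0 : s != 0 by move: q0; rewrite -s_sqrt expf_eq0.
have -> : q ^- m = s ^- m * s ^- m.
  by rewrite -s_sqrt -exprM mulnC exprM expr2 invfM.
have sm0 : s ^+ m != 0 by rewrite expf_neq0.
rewrite -[X in _ + X]divXMX -divXD; congr divX.
rewrite -!mul_polyC !polyCM !(polyCD, polyCN).
have eu : (u^-1)%:P * u%:P = 1 :> {poly K} by rewrite -polyCM mulVf.
have ea : a%:P * (a^-1)%:P = 1 :> {poly K} by rewrite -polyCM mulfV.
have ea' : a'%:P * (a'^-1)%:P = 1 :> {poly K} by rewrite -polyCM mulfV.
move: (Tp2 f) (u^-1)%:P u%:P (s ^- m)%:P a%:P (a^-1)%:P a'%:P (a'^-1)%:P eu ea ea'.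
move=> g v w y A A' B B' vw1 AA1 BB1; apply/eqP; rewrite -subr_eq0; apply/eqP.
transitivity ((1 - v * w) * (y * y * 'X * (B + B' - (A + A')) * g)
  + v * w * (y * y * y) * w * 'X * 'X * (B * B' - A * A') * g); first by ring.
by rewrite vw1 AA1 BB1; ring.
Qed.

(** Applying [T_+^2] and multiplying by the two linear factors returns the same product times its
    two next factors. The operator thus acts on it as multiplication by a Laurent polynomial, which
    turns out to be constant. *)
Lemma opA_pbasis m a u n : a != 0 -> u != 0 -> (n <= m)%N ->
  let th := a * q ^ (2 * n%:Z - m%:Z) in
  opA q s m a u (pbasis n (u * s ^- m) a m q)
  = (th + th^-1) *: pbasis n (u * s ^- m) a m q.
Proof.
move=> a0 u0 lenm th.
have s0 : s != 0 by move: q0; rewrite -s_sqrt expf_eq0.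
have sm0 : s ^+ m != 0 by rewrite expf_neq0.
pose c := u * s ^- m.
(* Both sides are [(x z; q^2)_(k+1)], split at its first and at its last factor. *)
have shift x k : (1 - x *: 'X) * Tp2 (qpoch (x *: 'X) (q ^+ 2)%:P k)
    = (1 - (x * q ^+ 2 ^+ k) *: 'X) * qpoch (x *: 'X) (q ^+ 2)%:P k :> {poly K}.
  have XQ (y r : K) : (y *: 'X) * r%:P = (y * r) *: 'X :> {poly K}.
    by rewrite -!mul_polyC polyCM mulrAC.
  have := qpochSl (x *: 'X) (q ^+ 2)%:P k; rewrite qpochS -polyC_exp !XQ.
  by rewrite /Tp2 !T_plus_qpoch -mulrA -expr2 => <-; rewrite mulrC.
rewrite /opA -/(Tp2 _) /pbasis.
have -> : (1 - (u * s ^- m * a) *: 'X) * (1 - (u * s ^- m * a^-1) *: 'X)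
   * Tp2 (qpoch ((u / s ^+ m * a) *: 'X) (q ^+ 2)%:P n *
   qpoch ((u / s ^+ m / a) *: 'X) (q ^+ 2)%:P (m - n)) = 
   ((1 - (u * s ^- m * a * q ^+ 2 ^+ n) *: 'X)
    * (1 - (u * s ^- m * a^-1 * q ^+ 2 ^+ (m - n)) *: 'X))
   * (qpoch ((u / s ^+ m * a) *: 'X) (q ^+ 2)%:P n *
   qpoch ((u / s ^+ m / a) *: 'X) (q ^+ 2)%:P (m - n)).
  rewrite /Tp2 !T_plusM -!/(Tp2 _) mulrACA !shift; ring.
move: (qpoch _ _ _ * _) => W.
(* The constant terms cancel, the terms in [z] give [th + th^-1], and the term in [z^2] cancels the
   summand [u q^j z] of the operator. *)
have -> : (u^-1 / s ^+ m) *: W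
    - (u^-1 / s ^+ m) *: ((1 - (u / s ^+ m * a * q ^+ 2 ^+ n) *: 'X)
                          * (1 - (u / s ^+ m / a * q ^+ 2 ^+ (m - n)) *: 'X) * W)
  = 'X * ((th + th^-1) *: W - (u * s ^+ m) *: ('X * W)).
  have qm : q ^+ m = s ^+ m * s ^+ m by rewrite -s_sqrt -exprM mulnC exprM expr2.
  have qm0 : q ^+ m != 0 by rewrite expf_neq0.
  have thE : th = u^-1 / s ^+ m * (u / s ^+ m * a * q ^+ 2 ^+ n).
    rewrite /th; have -> : q ^ (2 * n%:Z - m%:Z) = q ^+ 2 ^+ n / (s ^+ m * s ^+ m).
      by rewrite expfzDr // -invr_expz -qm -exprM.
    by field; nonzero.
  have thVE : th^-1 = u^-1 / s ^+ m * (u / s ^+ m / a * q ^+ 2 ^+ (m - n)).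
    have -> : q ^+ 2 ^+ (m - n) = q ^+ m * q ^+ m / (q ^+ 2 ^+ n).
      rewrite -exprD addnn -mul2n exprM -[in RHS](subnK lenm) exprD mulfK //.
      by rewrite !expf_neq0.
    have qn0 : q ^+ 2 ^+ n != 0 by rewrite !expf_neq0.
    by rewrite thE qm; field; nonzero.
  have usE : u * s ^+ m = u^-1 / s ^+ m * (u / s ^+ m * a * q ^+ 2 ^+ n)
                          * (u / s ^+ m / a * q ^+ 2 ^+ (m - n)).
    have -> : q ^+ 2 ^+ (m - n) = q ^+ m * q ^+ m / (q ^+ 2 ^+ n).
      rewrite -exprD addnn -mul2n exprM -[in RHS](subnK lenm) exprD mulfK //.
      by rewrite !expf_neq0.
    have qn0 : q ^+ 2 ^+ n != 0 by rewrite !expf_neq0.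
    by rewrite qm; field; nonzero.
  rewrite thVE thE usE.
  move: (u^-1 / _) (_ * _ ^+ n) (_ * _ ^+ (m - n)) => k x y.
  by rewrite -!mul_polyC !polyCD !polyCM; ring.
by rewrite divXMX addrC subrK.
Qed.

End Operators.

(** * Powers of q avoided by the parameters *)

Section Avoidance.
Variable K : numFieldType.
Implicit Types (q a b c : K).

Definition avoids_powers q N a := forall n : int,
  - N%:Z + 1 <= n <= N%:Z - 1 -> a != q ^ n /\ - a != q ^ n.

Lemma avoids_powersW q N N' a : (N <= N')%N ->
  avoids_powers q N' a -> avoids_powers q N a.
Proof. by move=> leN aN n n_in; apply: aN; lia. Qed.

(** The exponent satisfies [|2n - m2| <= m2], so the shift uses up at most [m2] of the margin. *)
Lemma avoids_powers_shift q m1 m2 a n : q != 0 -> (n <= m2)%N ->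
  avoids_powers q (m1 + m2) a ->
  avoids_powers q m1 (a * q ^ (2 * n%:Z - m2%:Z)).
Proof.
move=> q0 len aN k k_in.
have [] := aN (k - (2 * n%:Z - m2%:Z)); first by lia.
rewrite expfzDr // -invr_expz.
have := expfz_neq0 (2 * n%:Z - m2%:Z) q0; move: (q ^ (2 * _ - _)) => x x0 a1 a2.
split; [apply: contra a1 | apply: contra a2] => /eqP <-; apply/eqP; field; exact: x0.
Qed.

Lemma avoids_powersV q N a : avoids_powers q N a -> avoids_powers q^-1 N a^-1.
Proof.
move=> aN n n_in; have [a1 a2] := aN n n_in.
by rewrite exprz_inv -invr_expz -invrN !(inj_eq invr_inj).
Qed.

(** The gap factors as [c/a (a q^l - q^p)(a q^l + q^p)], so it vanishes only if [a] or [-a] is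
    [q^(p-l)], and [|p - l| < m]. *)
Lemma avoids_powers_gap q m a c l p : q != 0 -> a != 0 -> c != 0 ->
  avoids_powers q m a -> (l + p < m)%N ->
  node_gap (c * a) (c / a) (q ^+ 2) (q ^+ 2) l p != 0.
Proof.
move=> q0 a0 c0 aN lt_lp.
have -> : node_gap (c * a) (c / a) (q ^+ 2) (q ^+ 2) l p
    = c / a * ((a * q ^+ l - q ^+ p) * (a * q ^+ l + q ^+ p)).
  by rewrite /node_gap -!exprM ![(2 * _)%N]mulnC !exprM; field; nonzero.
have [] := aN (p%:Z - l%:Z); first by lia.
rewrite expfzDr // -invr_expz -!exprnP => a1 a2.
have := expf_neq0 l q0; move: (q ^+ l) a1 a2 => x a1 a2 x0.
rewrite !mulf_neq0 ?invr_eq0 // ?subr_eq0 ?addr_eq0.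
  by apply: contra a1 => /eqP <-; rewrite mulfK.
by apply: contra a2 => /eqP e; apply/eqP; rewrite -[q ^+ p]opprK -e; field.
Qed.

Lemma pbasis_poly_basis q m a c : q != 0 -> a != 0 -> c != 0 ->
  avoids_powers q m a -> poly_basis m (fun l => pbasis l c a m q).
Proof.
move=> q0 a0 c0 aN; apply: pair_basis_poly_basis => l p.
exact: avoids_powers_gap.
Qed.

End Avoidance.

(** * Eigenbases of the coupled operators *)

Section Eigenbases.
Variables (K : numFieldType) (q s : K) (m1 m2 : nat) (a u1 u2 : K).
Hypotheses (q0 : q != 0) (s_sqrt : s ^+ 2 = q).
Hypotheses (a0 : a != 0) (u10 : u1 != 0) (u20 : u2 != 0).
Hypothesis a_avoids : avoids_powers q (m1 + m2) a.

Let scale_neq0 m u : u != 0 -> u * s ^- m != 0.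
Proof.
move=> u0; have s0 : s != 0 by move: q0; rewrite -s_sqrt expf_eq0.
by rewrite mulf_neq0 // invr_eq0 expf_neq0.
Qed.

Let shift_neq0 e : a * q ^ e != 0.
Proof. by rewrite mulf_neq0 // expfz_neq0. Qed.

(** The second factor is an eigenvector of [A2] with eigenvalue [a' + 1/a'], where
    [a' = a q^(2 n2 - m2)]. The coproduct term then changes [a] into [a'] in [A1], and the first
    factor is an eigenvector of the operator so obtained. *)
Lemma opA12_ubasis n1 n2 : (n1 <= m1)%N -> (n2 <= m2)%N ->
  let th := a * q ^ (2 * n2%:Z - m2%:Z) * q ^ (2 * n1%:Z - m1%:Z) in
  opA12 q s m1 m2 a u1 u2 (ubasis q s m1 m2 a u1 u2 n1 n2)
  = (th + th^-1)%:P *: ubasis q s m1 m2 a u1 u2 n1 n2.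
Proof.
move=> le1 le2 th; rewrite /opA12 /ubasis; cbv zeta.
rewrite on1_tens; last by move=> c f; exact: opAZ.
rewrite on2_tens; last by move=> c f; exact: opAZ.
rewrite (opA_pbasis q0 s_sqrt a0 u20 le2) tensZr -scalerBl -polyCB -!tensZl.
rewrite on1_tens; last by move=> c f; exact: Tp2Z.
rewrite Tp2Z -tensZl -tensDl scalerA (opA_shift q0 s_sqrt) //.
by rewrite (opA_pbasis q0 s_sqrt _ u10 le1).
Qed.

Lemma opA21_ubarbasis n1 n2 : (n1 <= m1)%N -> (n2 <= m2)%N ->
  let th := a * q ^ (2 * n1%:Z - m1%:Z) * q ^ (2 * n2%:Z - m2%:Z) in
  opA21 q s m1 m2 a u1 u2 (ubarbasis q s m1 m2 a u1 u2 n1 n2)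
  = (th + th^-1)%:P *: ubarbasis q s m1 m2 a u1 u2 n1 n2.
Proof.
move=> le1 le2 th; rewrite /opA21 /ubarbasis; cbv zeta.
rewrite on2_tens; last by move=> c f; exact: opAZ.
rewrite on2_tens; last by move=> c f; exact: Tp2Z.
rewrite on1_tens; last by move=> c f; exact: opAZ.
rewrite (opA_pbasis q0 s_sqrt a0 u10 le1) tensZl -scalerBl -polyCB -!tensZr.
rewrite -tensDr scalerA (opA_shift q0 s_sqrt) //.
by rewrite (opA_pbasis q0 s_sqrt _ u20 le2).
Qed.

Lemma ubasis_eigenbasis :
  eigenbasis m1 m2 (opA12 q s m1 m2 a u1 u2) (ubasis q s m1 m2 a u1 u2).
Proof.
split=> [|n1 n2 le1 le2]; last by eexists; exact: opA12_ubasis.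
apply: tens_is_basis => [n2 le2|]; apply: pbasis_poly_basis => //.
- exact: scale_neq0.
- exact: avoids_powers_shift.
- exact: scale_neq0.
- by apply: avoids_powersW a_avoids; rewrite leq_addl.
Qed.

Lemma ubarbasis_eigenbasis :
  eigenbasis m1 m2 (opA21 q s m1 m2 a u1 u2) (ubarbasis q s m1 m2 a u1 u2).
Proof.
split=> [|n1 n2 le1 le2]; last by eexists; exact: opA21_ubarbasis.
apply: is_basis_swap.
pose g n2 n1 := pbasis n2 (u2 * s ^- m2) (a * q ^ (2 * n1%:Z - m1%:Z)) m2 q.
pose h n1 := pbasis n1 (u1 * s ^- m1) a m1 q.
have -> : (fun n2 n1 => swapXY (ubarbasis q s m1 m2 a u1 u2 n1 n2))
          = (fun n2 n1 => tens (g n2 n1) (h n1)).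
  by apply/funext => n2; apply/funext => n1; rewrite swapXY_tens.
apply: tens_is_basis => [n1 le1|]; apply: pbasis_poly_basis => //.
- exact: scale_neq0.
- by apply: avoids_powers_shift => //; rewrite addnC.
- exact: scale_neq0.
- by apply: avoids_powersW a_avoids; rewrite leq_addr.
Qed.

End Eigenbases.

(** * Inversion of all parameters *)

Section Inversion.
Variables (K : numFieldType) (q s : K) (m1 m2 : nat) (b u1 u2 : K).

Lemma opB_opA m u : opB q s m b u = opA q^-1 s^-1 m b^-1 u^-1.
Proof.
apply/funext => f; rewrite /opB /opA !exprVn !invrK.
(* Inverting [b] exchanges the two linear factors. *)
congr (_ + divX (_ - _ *: (_ * _))); exact: mulrC.
Qed.

Lemma opB21_opA12 :
  opB21 q s m1 m2 b u1 u2 = opA12 q^-1 s^-1 m1 m2 b^-1 u1^-1 u2^-1.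
Proof.
apply/funext => F; rewrite /opB21 /opA12; cbv zeta.
by rewrite !opB_opA exprVn !invrK [b^-1 + b]addrC.
Qed.

Lemma opB12_opA21 :
  opB12 q s m1 m2 b u1 u2 = opA21 q^-1 s^-1 m1 m2 b^-1 u1^-1 u2^-1.
Proof.
apply/funext => F; rewrite /opB12 /opA21; cbv zeta.
by rewrite !opB_opA exprVn !invrK [b^-1 + b]addrC.
Qed.

Lemma wbarbasis_ubasis :
  wbarbasis q s m1 m2 b u1 u2 = ubasis q^-1 s^-1 m1 m2 b^-1 u1^-1 u2^-1.
Proof.
apply/funext => n1; apply/funext => n2; rewrite /wbarbasis /ubasis.
rewrite !exprVn !invrK exprz_inv opprB ![s ^+ _ * _]mulrC //.
Qed.

Lemma wbasis_ubarbasis :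
  wbasis q s m1 m2 b u1 u2 = ubarbasis q^-1 s^-1 m1 m2 b^-1 u1^-1 u2^-1.
Proof.
apply/funext => n1; apply/funext => n2; rewrite /wbasis /ubarbasis.
rewrite !exprVn !invrK exprz_inv opprB ![s ^+ _ * _]mulrC //.
Qed.

End Inversion.

(** * Overlap coefficients in two variables *)

Section Overlap.
Variables (K : numFieldType) (q s : K) (m1 m2 : nat) (a b u1 u2 : K).
Hypotheses (q0 : q != 0) (q_nru : not_root_of_unity q) (s_sqrt : s ^+ 2 = q).
Hypotheses (a0 : a != 0) (b0 : b != 0) (u10 : u1 != 0) (u20 : u2 != 0).
Hypotheses (a_avoids : avoids_powers q (m1 + m2) a).

Let pbasis_expand m u a' b' k : u != 0 -> a' != 0 -> b' != 0 ->
  avoids_powers q m a' -> (k <= m)%N ->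
  pbasis k (s ^+ m * u^-1) b'^-1 m q^-1 =
  \sum_(l < m.+1) Rcoef q m k l a' b' u *: pbasis l (u * s ^- m) a' m q.
Proof.
move=> u0 a'0 b'0 aN lek.
have s0 : s != 0 by move: q0; rewrite -s_sqrt expf_eq0.
apply: Rcoef_expand => // l p ltlp; apply: avoids_powers_gap aN ltlp => //.
by rewrite mulf_neq0 // invr_eq0 expf_neq0.
Qed.

Let shift_neq0 (x : K) e : x != 0 -> x * q ^ e != 0.
Proof. by move=> x0; rewrite mulf_neq0 // expfz_neq0. Qed.

(** The second factor is expanded first, because the target basis for [z1] depends on [l2]. The
    first factor is then expanded with the parameters shifted by [l2] and [k2]. *)
Lemma wbarbasis_expand k1 k2 : (k1 <= m1)%N -> (k2 <= m2)%N ->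
  wbarbasis q s m1 m2 b u1 u2 k1 k2 =
  \sum_(l1 < m1.+1) \sum_(l2 < m2.+1)
    (Scoef q m1 m2 a b u1 u2 k1 k2 l1 l2)%:P *: ubasis q s m1 m2 a u1 u2 l1 l2.
Proof.
move=> le1 le2; rewrite /wbarbasis /ubasis /Scoef.
have a2 : avoids_powers q m2 a by apply: avoids_powersW a_avoids; rewrite leq_addl.
rewrite (pbasis_expand u20 a0 b0 a2 le2) tens_sumZr exchange_big.
apply: eq_bigr => l2 _ /=.
have -> : b^-1 * q ^ (m2%:Z - 2 * k2%:Z) = (b * q ^ (2 * k2%:Z - m2%:Z))^-1.
  by rewrite invfM invr_expz opprB.
rewrite (@pbasis_expand m1 u1 (a * q ^ (2 * l2%:Z - m2%:Z))) ?shift_neq0 //; last first.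
  by apply: avoids_powers_shift => //; rewrite -ltnS.
rewrite tens_sumZl scaler_sumr; apply: eq_bigr => l1 _.
by rewrite scalerA -polyCM mulrC.
Qed.

(** Here the target basis for [z2] depends on [l1], so the first factor is expanded first. *)
Lemma wbasis_expand k1 k2 : (k1 <= m1)%N -> (k2 <= m2)%N ->
  wbasis q s m1 m2 b u1 u2 k1 k2 =
  \sum_(l1 < m1.+1) \sum_(l2 < m2.+1)
    (Sbarcoef q m1 m2 a b u1 u2 k1 k2 l1 l2)%:P *: ubarbasis q s m1 m2 a u1 u2 l1 l2.
Proof.
move=> le1 le2; rewrite /wbasis /ubarbasis /Sbarcoef.
have a1 : avoids_powers q m1 a by apply: avoids_powersW a_avoids; rewrite leq_addr.
rewrite (pbasis_expand u10 a0 b0 a1 le1) tens_sumZl.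
apply: eq_bigr => l1 _ /=.
have -> : b^-1 * q ^ (m1%:Z - 2 * k1%:Z) = (b * q ^ (2 * k1%:Z - m1%:Z))^-1.
  by rewrite invfM invr_expz opprB.
rewrite (@pbasis_expand m2 u2 (a * q ^ (2 * l1%:Z - m1%:Z))) ?shift_neq0 //; last first.
  by apply: avoids_powers_shift; rewrite // 1?addnC // -ltnS.
rewrite tens_sumZr scaler_sumr; apply: eq_bigr => l2 _.
by rewrite scalerA -polyCM.
Qed.

End Overlap.

Local Open Scope complex_scope.

Theorem proposition4p8 (R : realType) (q s : R[i]) (m1 m2 : nat)
    (a b u1 u2 : R[i])
    (q_neq0 : q != 0) (q_nru : not_root_of_unity q) (s_sqrt : s ^+ 2 = q)
    (a_neq0 : a != 0) (b_neq0 : b != 0) (u1_neq0 : u1 != 0) (u2_neq0 : u2 != 0)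
    (cond_i : forall e1 e2 : int,
        e1 \in [:: 1; -1] -> e2 \in [:: 1; -1] ->
        general_position q (qstring q m1 ((q / u1 ^+ 2) ^ e1))
                           (qstring q m2 ((q / u2 ^+ 2) ^ e2)))
    (cond_ii1 : forall x : R[i], x = a * b \/ x = a / b ->
        ~ (qstring q m1 (q / u1 ^+ 2) `|` qstring q m1 (q / u1 ^+ 2)^-1) x)
    (cond_ii2 : forall x : R[i], x = a * b \/ x = a / b ->
        ~ (qstring q m2 (q / u2 ^+ 2) `|` qstring q m2 (q / u2 ^+ 2)^-1) x)
    (cond_iii : forall n : int,
        - m1%:Z - m2%:Z + 1 <= n <= m1%:Z + m2%:Z - 1 ->
        [/\ a != q ^ n, - a != q ^ n, b != q ^ n & - b != q ^ n]) :
  overlap_coefficients m1 m2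
    (opA12 q s m1 m2 a u1 u2) (opB21 q s m1 m2 b u1 u2)
    (ubasis q s m1 m2 a u1 u2) (wbarbasis q s m1 m2 b u1 u2)
    (Scoef q m1 m2 a b u1 u2)
  /\
  overlap_coefficients m1 m2
    (opA21 q s m1 m2 a u1 u2) (opB12 q s m1 m2 b u1 u2)
    (ubarbasis q s m1 m2 a u1 u2) (wbasis q s m1 m2 b u1 u2)
    (Sbarcoef q m1 m2 a b u1 u2).
Proof.
have s_sqrtV : s^-1 ^+ 2 = q^-1 by rewrite exprVn s_sqrt.
have a_avoids : avoids_powers q (m1 + m2) a.
  by move=> n n_in; have [] := cond_iii n ltac:(lia).
(* The eigenbases of the operators B are obtained at inverted parameters, so the condition on [b] is
   needed for [b^-1] and powers of [q^-1]. *)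
have b_avoids : avoids_powers q^-1 (m1 + m2) b^-1.
  by apply: avoids_powersV => n n_in; have [] := cond_iii n ltac:(lia).
split; split.
- exact: ubasis_eigenbasis.
- by rewrite opB21_opA12 wbarbasis_ubasis; apply: ubasis_eigenbasis; rewrite ?invr_eq0.
- by move=> k1 k2; exact: wbarbasis_expand.
- exact: ubarbasis_eigenbasis.
- by rewrite opB12_opA21 wbasis_ubarbasis; apply: ubarbasis_eigenbasis; rewrite ?invr_eq0.
- by move=> k1 k2; exact: wbasis_expand.
Qed.
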